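(* Let $n\ge 52$ and let $p$ be a nonnegative integer with $p<(n-1)(n-3)$. Then there exists a symmetric set $S\subseteq S_n$ with $|S|=p$, $\iota_n\notin S$ and $\delta_n\notin S$ if and only if (exactly) one of the following holds: (1) $p=qn-r$ for some integers $0\le r\le q<n-3$; (2) $n$ is even and $p=\frac{n(n-3)}{2}+c(n-1)$ for some integer $c\ge 0$; (3) $n$ is odd and $p=\binom{n-1}{2}+cn$ for some integer $c\ge 0$.
   Context: $S_n$ is the symmetric group on $[n]=\{1,\dots,n\}$; permutations are written in one-line notation. For $w\in S_n$, $\mathrm{Des}(w)=\{i\in[n-1] : w(i)>w(i+1)\}$. For $D\subseteq[n-1]$, $F_{n,D}=\sum x_{i_1}\cdots x_{i_n}$, summed over $i_1\le\cdots\le i_n$ with $i_j<i_{j+1}$ whenever $j\in D$ (Gessel's fundamental quasisymmetric function). For $S\subseteq S_n$, $Q(S)=\sum_{w\in S}F_{n,\mathrm{Des}(w)}$, and $S$ is symmetric if $Q(S)$ is a symmetric function. $\iota_n=12\cdots n$ and $\delta_n=n\cdots 21$. *)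

(* Defs.v *)
From mathcomp Require Import all_boot all_fingroup.
Set Implicit Arguments. Unset Strict Implicit. Unset Printing Implicit Defensive.

(* Permutations of [n] are {perm 'I_n}; the point i+1 of [n] is encoded by i : 'I_n. *)

Definition oneline n (w : {perm 'I_n}) : seq nat :=
  [seq (val (w i)).+1 | i <- enum 'I_n].

(* value w(j) for 1-based j in [n] *)
Definition pval n (w : {perm 'I_n}) (j : nat) : nat := nth 0 (oneline w) j.-1.

Definition Des n (w : {perm 'I_n}) : pred nat :=
  [pred i | (0 < i < n) && (pval w i > pval w i.+1)].

(* Formal power series in the variables x_0, x_1, x_2, ... with nat coefficients:
   a monomial x_{w_1} x_{w_2} ... x_{w_k} is represented by any word w : seq nat
   listing the variable indices with multiplicity; a series is given by its
   coefficient function on words (which must only depend on the multiset of w). *)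

(* Coefficient of the monomial of the word w in Gessel's F_{n,D}:
   F_{n,D} = sum over i_1 <= ... <= i_n with i_j < i_{j+1} for j in D of x_{i_1}...x_{i_n}.
   The monomial of w arises from exactly one weakly increasing sequence, namely sort w. *)
Definition Fcoef n (D : pred nat) (w : seq nat) : nat :=
  let v := sort leq w in
  ((size w == n) &&
   all (fun j => (j \in D) ==> (nth 0 v j.-1 < nth 0 v j)) (iota 1 n.-1) : nat).

Definition Qcoef n (S : {set {perm 'I_n}}) (w : seq nat) : nat :=
  \sum_(u in S) Fcoef n (Des u) w.

Definition symmetric_set n (S : {set {perm 'I_n}}) : Prop :=
  forall (sigma : nat -> nat), bijective sigma ->
    forall w : seq nat, Qcoef S (map sigma w) = Qcoef S w.

Definition iota_perm n : {perm 'I_n} := 1%g.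
Definition delta_perm n : {perm 'I_n} := perm (@rev_ord_inj n).

Definition cond1 (n p : nat) : Prop :=
  exists q r : nat, [/\ r <= q, q < n - 3 & p + r = q * n].
Definition cond2 (n p : nat) : Prop :=
  ~~ odd n /\ exists c : nat, p = (n * (n - 3)) %/ 2 + c * (n - 1).
Definition cond3 (n p : nat) : Prop :=
  odd n /\ exists c : nat, p = 'C(n - 1, 2) + c * n.

(* Main.v *)
Require Import Defs.
From mathcomp Require Import all_boot all_fingroup.
From mathcomp Require Import order ssralg ssrnum ssrint zify ring.
Set Implicit Arguments. Unset Strict Implicit. Unset Printing Implicit Defensive.

(** Record for each permutation which positions of [1 .. n-1] are ascents, and split a pattern of
    required ascents, required descents and free positions into blocks at its free positions.
    Symmetry of [Q(S)] means that the number of members of [S] matching a pattern depends only on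
    the multiset of blocks.  In particular the restrictions of [S] to the odd positions form an
    exchangeable family, so a member with between [3] and [h-3] ascents among the [h = n/2] odd
    positions would produce [C(h,3) >= (n-1)(n-3)] members; this is where [52 <= n] enters.
    Hence [S] splits into the members with few ascents and those with few descents, and the two
    parts are treated alike.  In the first part the ascent set has no three pairwise nonadjacent
    elements, so its number of runs [r] is 1 or 2, and [2N = 3 E(r) - E(r^2)] expresses the size
    [N] through the seven numbers of members whose ascent set contains a given configuration of
    runs of lengths 1, 2, 3, 4, 1+1, 2+1, 2+2.  Rewriting these in terms of five nonnegative exact
    counts gives
    [N = (n-1) a + b + n(n-1)/2 z + n(n-3)/2 t + (n(n-2)-1) y] with [b <= a + t + y];
    the size bound forces [y = 0], so [N] is a nonnegative combination of [n-1], [n], [n(n-1)/2],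
    [n(n-3)/2] and [C(n-1,2)].
    Conversely, if [al], [ga], [de], [ep] permutations are taken for each descent set [{1}] or
    [{n-1}], [{i}] with [1 < i < n-1], [{i,i+1}], and [{i,j}] with [j > i+1], where
    [al + ep = ga + de], then the coefficient of a word in [Q(S)] depends only on its number of
    distinct letters and its number of letters occurring once. *)

(** * Patterns, blocks and exchangeability *)

(* [Some true]: ascent, [Some false]: descent, [None]: free. *)
Definition letter := option bool.

Fixpoint matches (x : seq letter) (f : nat -> bool) (k : nat) : bool :=
  if x is o :: x' then (if o is Some l then f k == l else true) && matches x' f k.+1
  else true.

(* Every block is closed by a free position, so that patterns on [n-1] positions have length [n];
   position [n] is a dummy. *)
Definition join (bs : seq (seq letter)) : seq letter :=
  flatten [seq rcons b None | b <- bs].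

Lemma matches_cat x y f k : matches (x ++ y) f k = matches x f k && matches y f (k + size x).
Proof.
elim: x k => [|o x IH] k /=; first by rewrite addn0.
by rewrite IH andbA addSnnS.
Qed.

Lemma join_cat bs1 bs2 : join (bs1 ++ bs2) = join bs1 ++ join bs2.
Proof. by rewrite /join map_cat flatten_cat. Qed.

Lemma size_join bs : size (join bs) = sumn (map size bs) + size bs.
Proof.
elim: bs => [|b bs IH] //=; rewrite /join /= size_cat size_rcons -/(join bs) IH; lia.
Qed.

Lemma perm_size_join bs bs' : perm_eq bs bs' -> size (join bs) = size (join bs').
Proof.
by move=> p; rewrite !size_join (perm_size p) (perm_sumn (perm_map size p)).
Qed.

(* A letter is repeated exactly where an ascent is required: then the coefficient of the word in
   [F_{n,Des u}] tells whether [u] matches the pattern. *)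
Fixpoint word (c : nat) (x : seq letter) : seq nat :=
  if x is o :: x' then c :: word (if o is Some _ then c else c.+1) x' else [::].

(** The multiplicities of the successive letters of [word]; [a] counts the occurrences of the
    current letter already read. *)
Fixpoint comp (a : nat) (x : seq letter) : seq nat :=
  if x is o :: x' then if o is Some _ then comp a.+1 x' else a.+1 :: comp 0 x'
  else if 0 < a then [:: a] else [::].

Fixpoint blockword (c : nat) (al : seq nat) : seq nat :=
  if al is a :: al' then nseq a c ++ blockword c.+1 al' else [::].

Lemma size_word c x : size (word c x) = size x.
Proof. by elim: x c => //= o x IH c; rewrite IH. Qed.

Lemma nseq_cons a (c : nat) s : nseq a c ++ c :: s = nseq a.+1 c ++ s.
Proof. by elim: a => //= a ->. Qed.

Lemma word_blockword a c x : nseq a c ++ word c x = blockword c (comp a x).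
Proof.
elim: x a c => [|[l|] x IH] a c /=.
- by case: a.
- by rewrite nseq_cons IH.
- by rewrite nseq_cons -(IH 0).
Qed.

Lemma comp_rcons_cat a b y : comp a (rcons b None ++ y) = comp a (rcons b None) ++ comp 0 y.
Proof. by elim: b a => [|[l|] b IH] a //=; rewrite IH. Qed.

Lemma comp_join bs : comp 0 (join bs) = flatten [seq comp 0 (rcons b None) | b <- bs].
Proof.
by elim: bs => //= b bs <-; rewrite /join /= comp_rcons_cat.
Qed.

Lemma count_blockword c al k :
  count_mem k (blockword c al) = if c <= k then nth 0 al (k - c) else 0.
Proof.
elim: al c => [|a al IH] c /=; first by rewrite nth_nil if_same.
rewrite count_cat count_nseq IH /=.
case: (ltngtP c k) => h; rewrite ?mul1n ?mul0n ?add0n //.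
- by rewrite (_ : k - c = (k - c.+1).+1) //; lia.
- by rewrite h subnn addn0.
Qed.

Lemma perm_blockword al be : perm_eq al be ->
  exists2 s : nat -> nat, bijective s &
    perm_eq (map s (blockword 0 al)) (blockword 0 be).
Proof.
move/(perm_iotaP 0) => [ix pis ->]; set m := size be in pis.
have uis : uniq ix by rewrite (perm_uniq pis) iota_uniq.
have sis : size ix = m by rewrite (perm_size pis) size_iota.
have mis k : (k \in ix) = (k < m) by rewrite (perm_mem pis) mem_iota.
(* The default value [k] extends the permutation of the indices by the identity, which makes it a
   bijection of [nat]. *)
pose s k := nth k ix k.
pose t j := if j < m then index j ix else j.
have sK : cancel s t.
  move=> k; rewrite /s /t; case: (ltnP k m) => h.
    have := mem_nth k (n := k) (s := ix); rewrite sis h => /(_ isT).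
    by rewrite mis => ->; rewrite index_uniq ?sis.
  by rewrite nth_default ?sis // ltnNge h.
have tK : cancel t s.
  move=> j; rewrite /s /t; case: (ltnP j m) => h; first by rewrite nth_index ?mis.
  by rewrite nth_default ?sis.
exists s; first by exists t.
rewrite /perm_eq; apply/allP => j _ /=; apply/eqP.
rewrite -(tK j) count_map (eq_count (a2 := pred1 (t j))); last first.
  by move=> k /=; rewrite (inj_eq (can_inj sK)).
rewrite !count_blockword /= !subn0.
case: (ltnP (t j) m) => h.
  rewrite (nth_map 0) ?sis //; congr nth; rewrite /s.
  by apply: set_nth_default; rewrite sis.
rewrite nth_default ?size_map ?sis // /s nth_default ?sis //.
by rewrite nth_default ?sis.
Qed.

Lemma sorted_word c x : sorted leq (word c x).
Proof.
case: x => //= o x.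
elim: x o c => //= o' x IH o c; rewrite IH andbT; case: o => //=.
Qed.

Lemma nth_word_lt x c k : k.+1 < size x ->
  (nth 0 (word c x) k < nth 0 (word c x) k.+1) = (nth None x k == None).
Proof.
elim: x c k => // o x IH c [|k] /=; last by move=> h; rewrite IH.
by case: x {IH} => //= o' x _; case: o => /=; rewrite ?ltnn ?ltnSn.
Qed.

Lemma matchesP x f k : reflect (forall j, j < size x ->
   forall l, nth None x j = Some l -> f (k + j) = l) (matches x f k).
Proof.
elim: x k => [|o x IH] k /=; first by apply: ReflectT.
apply: (iffP andP) => [[h /IH h'] [|j] //= lj l|h].
- by rewrite addn0 => e; move: h; rewrite e => /eqP.
- by move=> e; rewrite -addSnnS; apply: h'.
split; first by case: o h => // l /(_ 0 isT l erefl) /=; rewrite addn0 => ->.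
by apply/IH => j lj l e; rewrite addSnnS; apply: (h j.+1).
Qed.

Section Exchange.
Variables (T : finType) (S : {set T}) (bit : T -> nat -> bool).

Definition matching (x : seq letter) : nat := \sum_(u in S) matches x (bit u) 0.

Definition exchangeable n : Prop := forall bs bs' : seq (seq letter),
  perm_eq bs bs' -> size (join bs) = n -> matching (join bs) = matching (join bs').

Lemma matching_split p q :
  matching (p ++ None :: q) = matching (p ++ Some true :: q) + matching (p ++ Some false :: q).
Proof.
rewrite -big_split /=; apply: eq_bigr => u _; rewrite !matches_cat /=.
by case: matches; case: (bit u _); case: matches.
Qed.

Definition has_desc (x : seq letter) := count_mem (Some false) x.

Lemma join_mid s b t : join (s ++ b :: t) = join s ++ b ++ None :: join t.
Proof. by rewrite join_cat /join /= cat_rcons. Qed.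

(** Induction on the number of required descents: requiring a descent counts what a free position
    counts minus what a required ascent counts, and both of these patterns have fewer descents. The
    altered block, even with a free position inside, stays one element of the list, so the two lists
    remain permutations of each other. *)
Lemma exchangeable_ascents n :
  (forall bs bs' : seq (seq letter), perm_eq bs bs' -> size (join bs) = n ->
    has_desc (join bs) = 0 -> matching (join bs) = matching (join bs')) ->
  exchangeable n.
Proof.
move=> H bs bs'; move: {2}(has_desc _) (leqnn (has_desc (join bs))) => d.
elim: d bs bs' => [|d IH] bs bs' hd p sz.
  by apply: H => //; apply/eqP; rewrite -leqn0.
case: (posnP (has_desc (join bs))) => [/H|hpos]; first by apply.
have [b bin hb] : exists2 b, b \in bs & Some false \in b.
  move: hpos; rewrite /has_desc -has_count has_pred1 => /flattenP [b'].
  by move=> /mapP [b bin ->]; rewrite mem_rcons inE /= => hb; exists b.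
have bin' : b \in bs' by rewrite -(perm_mem p).
case/splitPr: bin p hd sz {hpos} => s t; case/splitPr: bin' => s' t'.
case/splitPr: hb => b1 b2 p hd sz.
have p0 : perm_eq (s ++ t) (s' ++ t').
  move: p; rewrite perm_sym perm_catC /= perm_sym perm_catC /= perm_cons.
  by rewrite perm_catC perm_sym perm_catC perm_sym.
have pb o : perm_eq (s ++ (b1 ++ o :: b2) :: t) (s' ++ (b1 ++ o :: b2) :: t').
  rewrite perm_catC /= perm_sym perm_catC /= perm_cons perm_catC perm_sym.
  by rewrite perm_catC.
have eqs o : forall s t, join (s ++ (b1 ++ o :: b2) :: t) =
   (join s ++ b1) ++ o :: (b2 ++ None :: join t).
  by move=> ? ?; rewrite join_mid -!catA.
move: hd sz; rewrite !eqs => hd sz.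
have hs : forall o, o != Some false ->
  matching (join (s ++ (b1 ++ o :: b2) :: t)) = matching (join (s' ++ (b1 ++ o :: b2) :: t')).
  move=> o ho; apply: IH => //.
    move: hd; rewrite eqs /has_desc !count_cat /= (negPf ho) /=; lia.
  by rewrite eqs -sz !size_cat.
have := hs None isT; have := hs (Some true) isT.
rewrite !eqs; set q := b2 ++ _.
rewrite (matching_split (join s ++ b1) q) (matching_split (join s' ++ b1) (b2 ++ None :: join t')).
by rewrite /q => -> /addnI.
Qed.

End Exchange.

(** Complementing the letters permutes the patterns. This lets members with few descents be handled
    as members with few ascents. *)
Lemma exchangeable_neg (T : finType) (S : {set T}) bit n :
  exchangeable S bit n -> exchangeable S (fun u j => ~~ bit u j) n.
Proof.
move=> H bs bs' p sz.
pose ng : letter -> letter := omap negb.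
have E b : matching S (fun u j => ~~ bit u j) (join b) = matching S bit (join (map (map ng) b)).
  have -> : join (map (map ng) b) = map ng (join b).
    elim: b => //= a b; rewrite /join /= map_cat => ->.
    by rewrite map_rcons.
  apply: eq_bigr => u _; congr (nat_of_bool _).
  elim: (join b) 0 => //= o x IH k; rewrite IH; case: o => //= l.
  by case: (bit u k); case: l.
rewrite !E; apply: H; first exact: perm_map.
rewrite -sz !size_join size_map -map_comp; congr (sumn _ + _).
by apply: eq_map => b /=; rewrite size_map.
Qed.

(* Positions are counted from 0 here: [noDes u j] concerns the 1-based position [j+1]. *)
Definition noDes n (u : {perm 'I_n}) (j : nat) : bool := j.+1 \notin Des u.

Lemma Qcoef_word n (S : {set {perm 'I_n}}) x :
  size x = n -> has_desc x = 0 -> Qcoef S (word 0 x) = matching S (@noDes n) x.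
Proof.
move=> sx hx; apply: eq_bigr => u _; congr (nat_of_bool _).
rewrite sorted_sort ?sorted_word //; last exact: leq_trans.
rewrite size_word sx eqxx /=; apply/allP/matchesP => [h j lj l e|h j].
  have -> : l = true.
    case: l e => // e; move: hx; rewrite /has_desc => /eqP.
    rewrite -leqn0 leqNgt -has_count has_pred1 => /negP [].
    by rewrite -e mem_nth.
  (* At the dummy last position there is never a descent, so a required ascent holds there. *)
  rewrite /noDes add0n; case: (ltnP j n.-1) => hj; last first.
    by rewrite /Des inE negb_and; apply/orP; left; lia.
  have := h j.+1; rewrite mem_iota /= => /(_ ltac:(lia)).
  rewrite nth_word_lt ?e ?implybF //; lia.
rewrite mem_iota => hj; case: j hj => // j hj /=.
apply/implyP => jD; rewrite nth_word_lt; last lia.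
case e: (nth None x j) => [l|] //.
have lj : j < size x by rewrite sx; lia.
have := h j lj l e; rewrite /noDes add0n jD /= => hl.
move: hx; rewrite /has_desc => /eqP; rewrite -leqn0 leqNgt -has_count has_pred1 => /negP [].
by rewrite hl -e mem_nth.
Qed.

Lemma Qcoef_perm n (S : {set {perm 'I_n}}) w w' :
  perm_eq w w' -> Qcoef S w = Qcoef S w'.
Proof.
move=> p; apply: eq_bigr => u _; rewrite /Fcoef (perm_size p).
suff -> : sort leq w = sort leq w' by [].
by apply/perm_sortP => //; [exact: leq_total | exact: leq_trans | exact: anti_leq].
Qed.

(** Permuting the blocks of a descent-free pattern permutes the multiplicities in its word, which
    amounts to renaming the variables. *)
Lemma symmetric_exchangeable n (S : {set {perm 'I_n}}) :
  symmetric_set S -> exchangeable S (@noDes n) n.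
Proof.
move=> sym; apply: exchangeable_ascents => bs bs' p sz hd.
have sz' : size (join bs') = n by rewrite -(perm_size_join p).
have hd' : has_desc (join bs') = 0.
  have pj : perm_eq (join bs) (join bs') by apply/perm_flatten/perm_map.
  by rewrite -hd /has_desc (seq.permP pj).
rewrite -!Qcoef_word //.
have E b : word 0 (join b) = blockword 0 (comp 0 (join b)).
  by rewrite -word_blockword.
have pc : perm_eq (comp 0 (join bs)) (comp 0 (join bs')).
  by rewrite !comp_join; apply/perm_flatten/perm_map.
have [s bs_s ps] := perm_blockword pc.
by rewrite !E -(sym s bs_s) (Qcoef_perm _ ps).
Qed.

(** * Members with few ascents *)

Lemma bin_leS h k : k.*2 < h -> 'C(h, k) <= 'C(h, k.+1).
Proof.
move=> hk; rewrite -(leq_pmul2l (ltn0Sn k)) mul_bin_left leq_mul2r; lia.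
Qed.

(** Binomial coefficients increase up to the middle; above it, [k] is replaced by [h - k]. *)
Lemma bin3_le h k : 3 <= k -> k + 3 <= h -> 'C(h, 3) <= 'C(h, k).
Proof.
have mono i j : i <= j -> j.*2 <= h.+1 -> 'C(h, i) <= 'C(h, j).
  move=> /subnK <-; elim: (j - i) => // d IH hd.
  by apply: leq_trans (IH _) (bin_leS _); lia.
move=> k3 kh; case: (leqP k.*2 h.+1) => hk; first exact: mono.
rewrite -(bin_sub (m := k)); last lia.
by apply: mono; lia.
Qed.

Lemma bin3_bound n : 52 <= n -> (n - 1) * (n - 3) <= 'C(n./2, 3).
Proof.
move=> n52; set h := n./2; have hn : n <= h.*2.+1 by rewrite /h; lia.
have h26 : 26 <= h by rewrite /h; lia.
have := bin_ffact h 3; rewrite !ffactnS ffactn0 /= muln1 => e.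
(* As [n <= 2h + 1], it suffices that [h (h-1) (h-2) >= 6 * 2h * (2h-2)], that is [h >= 26]; this
   gives the constant 52. *)
have : h * (h.-1 * h.-1.-1) >= (n - 1) * (n - 3) * 6 by nia.
by rewrite -e (_ : 3`! = 6) // leq_pmul2r.
Qed.

Lemma perm_bool (s t : seq bool) :
  size s = size t -> count id s = count id t -> perm_eq s t.
Proof.
move=> es ec; rewrite /perm_eq; apply/allP => b _ /=; apply/eqP.
have T r : count_mem true r = count id r by apply: eq_count => -[].
case: b; rewrite ?T //.
have F (r : seq bool) : count_mem false r = size r - count id r.
  by rewrite -(count_predC id r) addKn; apply: eq_count => -[].
by rewrite !F es ec.
Qed.

Definition sing (l : bool) : seq letter := [:: Some l].

Lemma matches_singP ls f k : reflect (forall i, i < size ls -> f (k + i.*2) = nth false ls i)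
  (matches (join (map sing ls)) f k).
Proof.
elim: ls k => [|l ls IH] k; first by apply: ReflectT.
rewrite /join /= -/(join _); apply: (iffP andP) => [[/eqP h1 /IH h2] [|i] //= hi|h].
- by rewrite addn0.
- by rewrite -h2 // doubleS !addSnnS.
split; first by rewrite -[k]addn0 (h 0).
by apply/IH => i hi; rewrite !addSnnS -doubleS (h i.+1).
Qed.

Lemma join_nil e : join (nseq e [::]) = nseq e None.
Proof. by elim: e => // e IH; rewrite /join /= -/(join _) IH. Qed.

Lemma join1 b : join [:: b] = rcons b None.
Proof. by rewrite /join /= cats0. Qed.

Lemma matches_block b f k : matches (rcons b None) f k = matches b f k.
Proof. by rewrite -cats1 matches_cat andbT. Qed.

Lemma matches_None e f k : matches (nseq e None) f k.
Proof. by elim: e k => /=. Qed.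

Lemma size_join_sing ls : size (join (map sing ls)) = (size ls).*2.
Proof. by rewrite size_join; elim: ls => //= l ls IH; lia. Qed.

Ltac perm_blocks :=
  apply/seq.permP => a; do ! rewrite /= ?(count_cat, count_nseq, mulnDr); lia.

Section Family.
Variables (T : finType) (S : {set T}) (bit : T -> nat -> bool) (n : nat).
Hypothesis exch : exchangeable S bit n.

Lemma matching_pad bs e : matching S bit (join (bs ++ nseq e [::])) = matching S bit (join bs).
Proof.
by apply: eq_bigr => u _; rewrite join_cat matches_cat join_nil matches_None andbT.
Qed.

(** An empty block is a single free position. Hence exchangeability extends to patterns shorter than
    [n] and to lists that differ by empty blocks, as long as the padding fits. *)
Lemma matching_perm bs bs' e e' :
  perm_eq (bs ++ nseq e [::]) (bs' ++ nseq e' [::]) -> size (join bs) + e <= n ->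
  matching S bit (join bs) = matching S bit (join bs').
Proof.
move=> p sz; set d := n - (size (join bs) + e).
rewrite -(matching_pad bs (e + d)) -(matching_pad bs' (e' + d)); apply: exch.
  by rewrite !nseqD !catA perm_cat2r.
by rewrite join_cat join_nil size_cat size_nseq /d; lia.
Qed.

Lemma matching_gt0 x : 0 < matching S bit x -> exists2 u, u \in S & matches x (bit u) 0.
Proof.
case: (pickP [pred u | (u \in S) && matches x (bit u) 0]) => [u /andP [? ?] _|h].
  by exists u.
rewrite /matching big1 // => u uS; have := h u; rewrite /= uS /= => -> //.
Qed.

Lemma matching_pos x u : u \in S -> matches x (bit u) 0 -> 0 < matching S bit x.
Proof. by move=> uS h; rewrite /matching (bigD1 u) //= h. Qed.

Hypothesis n52 : 52 <= n.
Hypothesis cardS : #|S| < (n - 1) * (n - 3).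

Let h := n./2.
Let Y u : {set 'I_h} := [set i | bit u (val i).*2].

(** Singleton blocks occupy every other position. By exchangeability, if the trace of [u] on these
    positions has [k] elements, then every [k]-subset is the trace of a member; for
    [3 <= k <= h - 3] there are too many of them. *)
Lemma alternate_extreme u : u \in S -> #|Y u| < 3 \/ h < #|Y u| + 3.
Proof.
move=> uS; case: (ltnP #|Y u| 3) => k3; first by left.
case: (ltnP h (#|Y u| + 3)) => kh; first by right.
suff sub : [set A : {set 'I_h} | #|A| == #|Y u|] \subset Y @: S.
  have := leq_trans (subset_leq_card sub) (leq_imset_card _ _).
  rewrite card_draws card_ord; have := bin3_le k3 kh; have := bin3_bound n52.
  rewrite -/h; lia.
apply/subsetP => A; rewrite inE => /eqP cA.
pose ls (B : {set 'I_h}) := [seq i \in B | i <- enum 'I_h].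
have sl B : size (ls B) = h by rewrite size_map size_enum_ord.
have cl B : count id (ls B) = #|B|.
  by rewrite count_map cardE enumT -size_filter.
have mtl B v : matches (join (map sing (ls B))) (bit v) 0 = (Y v == B).
  apply/matches_singP/eqP => [hv|<- i].
    apply/setP => i; have hi : val i < size (ls B) by rewrite sl ltn_ord.
    rewrite inE; have := hv _ hi; rewrite add0n => ->.
    rewrite /ls (nth_map i) ?size_enum_ord ?ltn_ord //.
    by rewrite nth_ord_enum.
  move=> hi; have {}hi : i < h by rewrite -(sl (Y v)).
  rewrite /ls (nth_map (Ordinal hi)) ?size_enum_ord //.
  by rewrite -[i in RHS]/(val (Ordinal hi)) nth_ord_enum inE.
have /matching_gt0 [v vS] : 0 < matching S bit (join (map sing (ls A))).
  rewrite (matching_perm (bs' := map sing (ls (Y u))) (e := 0) (e' := 0)).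
  - by apply: (matching_pos uS); rewrite mtl.
  - by rewrite !cats0; apply: perm_map; apply: perm_bool; rewrite ?sl ?cl.
  - by rewrite size_join_sing sl /h; lia.
by rewrite mtl => /eqP <-; apply: imset_f.
Qed.

(* That is, no member of [S] has three ascents and three descents at pairwise nonadjacent positions. *)
Lemma no_three_three u bs ls e : u \in S -> matches (join bs) (bit u) 0 ->
  perm_eq bs (map sing ls ++ nseq e [::]) -> size (join bs) <= n ->
  3 <= count id ls -> 3 <= count negb ls -> False.
Proof.
move=> uS hu p sz cA cD.
have szl : (size ls).*2 <= n.
  by move: sz; rewrite (perm_size_join p) join_cat size_cat size_join_sing; lia.
(* Moving the empty blocks to the end yields a member [v] carrying the letters [ls] at positions 0,
   2, 4, and so on, against [alternate_extreme]. *)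
have := matching_pos uS hu; rewrite (matching_perm (bs' := map sing ls) (e := 0) (e' := e)).
- case/matching_gt0 => v vS /matches_singP hv.
  have lh : size ls <= h by rewrite /h; lia.
  have [f [finj fY]] : exists f : 'I_(size ls) -> 'I_h, injective f /\
      forall i, (f i \in Y v) = nth false ls i.
    exists (widen_ord lh); split; first by move=> i j /(congr1 val) /= /val_inj.
    by move=> i; rewrite inE /= -(hv i).
  pose A := [set i : 'I_(size ls) | nth false ls i].
  have cardA : #|A| = count id ls.
    transitivity (count id [seq nth false ls (val i) | i <- enum 'I_(size ls)]).
      rewrite count_map cardE -size_filter enumT; congr size.
      by apply: eq_filter => i; rewrite /= inE.
    by rewrite (map_comp (nth false ls) val) val_enum_ord -/(mkseq _ _) mkseq_nth.
  have h1 : count id ls <= #|Y v|.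
    rewrite -cardA -(card_imset _ finj); apply: subset_leq_card.
    by apply/subsetP => _ /imsetP [i iA ->]; rewrite fY; move: iA; rewrite inE.
  have h2 : count negb ls <= #|~: Y v|.
    have -> : count negb ls = #|~: A|.
      have := count_predC id ls; have := cardsC A; rewrite card_ord cardA.
      rewrite (eq_count (a1 := predC id) (a2 := negb)) //; lia.
    rewrite -(card_imset _ finj); apply: subset_leq_card.
    by apply/subsetP => _ /imsetP [i iA ->]; rewrite in_setC fY; move: iA; rewrite !inE.
  have := cardsC (Y v); rewrite card_ord.
  by case: (alternate_extreme vS) => //; lia.
- by rewrite cats0.
- by rewrite addn0.
Qed.

(* Five pairwise nonadjacent positions; by [no_three_three] the majority of ascents or descents
   does not depend on where the window is.  The lock keeps unification from unfolding the list. *)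
Definition win u c : seq bool := locked (mkseq (fun i => bit u (c + i.*2)) 5).

Definition small u := count id (win u 0) <= 2.

Lemma size_win u c : size (win u c) = 5.
Proof. by rewrite /win -lock size_mkseq. Qed.

Lemma count_negb_win u c : count negb (win u c) = 5 - count id (win u c).
Proof.
rewrite -(size_win u c) -(count_predC id) addKn; exact: eq_count.
Qed.

Lemma matches_sing_win ls u c : size ls = 5 ->
  matches (join (map sing ls)) (bit u) c = (ls == win u c).
Proof.
move=> sz; apply/matches_singP/eqP => [hu|-> i].
  apply: (@eq_from_nth _ false) => [|i]; rewrite sz ?size_win // => hi.
  by rewrite /win -lock nth_mkseq // hu ?sz.
by rewrite size_win => hi; rewrite /win -lock nth_mkseq.
Qed.

Lemma matches_insert_window p q ls u : size ls = 5 ->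
  matches (join (p ++ map sing ls ++ q)) (bit u) 0 =
  matches (join (p ++ nseq 10 [::] ++ q)) (bit u) 0 && (ls == win u (size (join p))).
Proof.
move=> sz; rewrite !join_cat !join_nil !matches_cat !matches_None size_join_sing sz.
by rewrite matches_sing_win // size_nseq add0n; case: (ls == _); rewrite ?andbF ?andbT.
Qed.

(** If the majorities differed, one window would supply three ascents and the other three
    descents. *)
Lemma win_far u c c' : u \in S -> c + 10 <= c' -> c' + 10 <= n ->
  (count id (win u c) <= 2) = (count id (win u c') <= 2).
Proof.
move=> uS hc hc'; set d := c' - c - 10.
suff H : ~ (3 <= count id (win u c ++ win u c') /\ 3 <= count negb (win u c ++ win u c')).
  move: H; rewrite !count_cat !count_negb_win.
  have := count_size id (win u c); have := count_size id (win u c'); rewrite !size_win.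
  lia.
case; apply: (no_three_three uS (e := c + d)
   (bs := nseq c [::] ++ map sing (win u c) ++ nseq d [::] ++ map sing (win u c'))).
- rewrite !join_cat !join_nil !matches_cat !matches_None size_join_sing !size_nseq /=.
  rewrite !matches_sing_win ?size_win // add0n eqxx /=; apply/eqP; congr win.
  by rewrite /d; lia.
- apply/seq.permP => a; rewrite map_cat !count_cat !count_nseq mulnDr; lia.
- rewrite !join_cat !join_nil !size_cat !size_join_sing !size_nseq !size_win /d; lia.
Qed.

Lemma win_indep u c : u \in S -> c + 10 <= n -> (count id (win u c) <= 2) = small u.
Proof.
move=> uS hc; case: (leqP 10 c) => h10; first by apply/esym/win_far.
(* Windows that may overlap are both compared with the window at 30, disjoint from each. *)
by rewrite /small (win_far (c' := 30) uS) ?(win_far (c := 0) (c' := 30) uS) //; lia.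
Qed.

(** The ten free positions hold a window, which has at least three descents because [u] is small;
    with three ascents outside it this contradicts [no_three_three]. *)
Lemma small_no_three p q e u : u \in S -> small u ->
  perm_eq (p ++ q) (nseq 3 (sing true) ++ nseq e [::]) ->
  size (join (p ++ nseq 10 [::] ++ q)) <= n ->
  ~~ matches (join (p ++ nseq 10 [::] ++ q)) (bit u) 0.
Proof.
move=> uS su pq sz; apply/negP => hu.
pose c := size (join p); have hc : c + 10 <= n.
  by move: sz; rewrite !join_cat join_nil !size_cat size_nseq /c; lia.
have hw : count id (win u c) <= 2 by rewrite win_indep.
have hm : matches (join (p ++ map sing (win u c) ++ q)) (bit u) 0.
  by rewrite matches_insert_window ?size_win // hu eqxx.
apply: (no_three_three (ls := nseq 3 true ++ win u c) (e := e) uS hm).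
- apply/seq.permP => a; have := seq.permP pq a; rewrite map_cat !count_cat map_nseq; lia.
- move: sz; rewrite !join_cat join_nil !size_cat size_nseq size_join_sing size_win; lia.
- by rewrite count_cat count_nseq.
- by rewrite count_cat count_nseq count_negb_win; lia.
Qed.

Lemma small_no_triple u i j k : u \in S -> small u ->
  i.+1 < j -> j.+1 < k -> k.+1 < n -> [&& bit u i, bit u j & bit u k] = false.
Proof.
move=> uS su ij jk kn; apply/negP => /and3P [bi bj bk].
pose d1 := j - i - 2; pose d2 := k - j - 2; pose d3 := n - k - 2.
pose bs := nseq i [::] ++ [:: sing true] ++ nseq d1 [::] ++ [:: sing true] ++
  nseq d2 [::] ++ [:: sing true] ++ nseq d3 [::].
have szb : size (join bs) = n.
  by rewrite /bs !join_cat !join_nil !size_cat !size_nseq /= /d1 /d2 /d3; lia.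
have hm : matches (join bs) (bit u) 0.
  rewrite /bs !join_cat !join_nil !matches_cat !matches_None !size_nseq /= !andbT add0n.
  have -> : i + 2 + d1 = j by rewrite /d1; lia.
  have -> : j + 2 + d2 = k by rewrite /d2; lia.
  by rewrite bi bj bk.
have cut d : 10 <= d -> nseq d ([::] : seq letter) = nseq 10 [::] ++ nseq (d - 10) [::].
  by move=> h10; rewrite -nseqD subnKC.
have fin p q e : bs = p ++ nseq 10 [::] ++ q ->
    perm_eq (p ++ q) (nseq 3 (sing true) ++ nseq e [::]) -> False.
  move=> e1 p1; have := small_no_three uS su p1.
  by rewrite -e1 szb leqnn hm => /(_ isT).
(* The three ascents and the free positions closing their blocks take 6 of at least 52 positions, so
   one of the four gaps can hold a window. *)
have : [|| 10 <= i, 10 <= d1, 10 <= d2 | 10 <= d3] by rewrite /d1 /d2 /d3; lia.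
case/or4P => h10.
- apply: (fin [::] _ (i - 10 + d1 + d2 + d3)); first by rewrite /bs (cut i) // -!catA.
  by perm_blocks.
- apply: (fin (nseq i [::] ++ [:: sing true]) _ (i + (d1 - 10) + d2 + d3)).
    by rewrite /bs (cut d1) // -!catA.
  by perm_blocks.
- apply: (fin (nseq i [::] ++ [:: sing true] ++ nseq d1 [::] ++ [:: sing true]) _
    (i + d1 + (d2 - 10) + d3)).
    by rewrite /bs (cut d2) // -!catA.
  by perm_blocks.
- apply: (fin (nseq i [::] ++ [:: sing true] ++ nseq d1 [::] ++ [:: sing true]
    ++ nseq d2 [::] ++ [:: sing true]) _ (i + d1 + d2 + (d3 - 10))).
    by rewrite /bs (cut d3) // -!catA.
  by perm_blocks.
Qed.

(** Smallness is not itself a pattern, but it is a disjunction over the contents [t] of a window.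
    Placing the window first fixes a reference arrangement of the blocks. *)
Definition small_count (ks : seq (seq letter)) : nat :=
  \sum_(t : 5.-tuple bool | count id t <= 2) matching S bit (join (map sing t ++ ks)).

(** By [win_indep], smallness can be read off from the window in the gap between [p] and [q]. For
    each content of that window the count is that of a pattern, so exchangeability carries it to the
    reference arrangement. *)
Lemma sum_small p q ks e : perm_eq (p ++ q) (ks ++ nseq e [::]) ->
  size (join (p ++ nseq 10 [::] ++ q)) <= n ->
  \sum_(u in S | small u) matches (join (p ++ nseq 10 [::] ++ q)) (bit u) 0 = small_count ks.
Proof.
move=> pq sz; pose c := size (join p); have hc : c + 10 <= n.
  by move: sz; rewrite !join_cat join_nil !size_cat size_nseq /c; lia.
transitivity (\sum_(t : 5.-tuple bool | count id t <= 2)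
   matching S bit (join (p ++ map sing t ++ q))); last first.
  apply: eq_bigr => t _; apply: (matching_perm (e := 0) (e' := e)).
    apply/seq.permP => a; have := seq.permP pq a.
    by rewrite cats0 !count_cat; lia.
  move: sz; rewrite !join_cat join_nil !size_cat size_nseq size_join_sing size_tuple; lia.
rewrite exchange_big big_mkcondr /=; apply: eq_bigr => u uS.
rewrite -(win_indep uS hc); set m := matches _ _ _.
have sw : size (win u c) == 5 by rewrite size_win.
have E (t : 5.-tuple bool) : matches (join (p ++ map sing t ++ q)) (bit u) 0 =
    m && (t == Tuple sw).
  by rewrite matches_insert_window ?size_tuple.
under eq_bigr do rewrite E.
case: ifP => hs; last first.
  rewrite big1 // => t ht; case: eqP => [et|_]; last by rewrite andbF.
  by move: ht; rewrite et /= hs.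
rewrite (bigD1 (Tuple sw)) //= eqxx andbT big1 ?addn0 // => t /andP [_ /negPf ->].
by rewrite andbF.
Qed.

Definition run u i k := all (bit u) (iota i k).

Lemma matches_run k u i : matches (nseq k (Some true)) (bit u) i = run u i k.
Proof. by rewrite /run; elim: k i => //= k IH i; rewrite IH eqb_id. Qed.

Lemma sum_run i k : i + k < n -> k <= 4 ->
  \sum_(u in S | small u) run u i k = small_count [:: nseq k (Some true)].
Proof.
move=> ik k4; pose d := n - i - k - 1.
pose bs := nseq i [::] ++ [:: nseq k (Some true)] ++ nseq d [::].
have szb : size (join bs) = n.
  by rewrite /bs !join_cat !join_nil !size_cat !size_nseq /= ?cats0 !size_rcons !size_nseq /d; lia.
transitivity (\sum_(u in S | small u) matches (join bs) (bit u) 0).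
  apply: eq_bigr => u _; congr nat_of_bool.
  by rewrite /bs !join_cat !join_nil !join1 !matches_cat !matches_block !matches_None size_nseq matches_run andbT.
have cut g : 10 <= g -> nseq g ([::] : seq letter) = nseq 10 [::] ++ nseq (g - 10) [::].
  by move=> h10; rewrite -nseqD subnKC.
have : (10 <= i) || (10 <= d) by rewrite /d; lia.
case/orP => h10.
- have e1 : bs = [::] ++ nseq 10 [::] ++ nseq (i - 10) [::] ++
     [:: nseq k (Some true)] ++ nseq d [::] by rewrite /bs (cut i) // -!catA.
  rewrite e1; apply: (@sum_small _ _ _ (i - 10 + d)); last by rewrite -e1 szb.
  by perm_blocks.
- have e1 : bs = (nseq i [::] ++ [:: nseq k (Some true)]) ++ nseq 10 [::] ++
     nseq (d - 10) [::] by rewrite /bs (cut d) // -!catA.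
  rewrite e1; apply: (@sum_small _ _ _ (i + (d - 10))); last by rewrite -e1 szb.
  by perm_blocks.
Qed.

Lemma sum_run2 i k j l : i + k < j -> j + l < n -> k <= 4 -> l <= 4 ->
  \sum_(u in S | small u) (run u i k && run u j l) =
  small_count [:: nseq k (Some true); nseq l (Some true)].
Proof.
move=> ij jn k4 l4; pose d1 := j - i - k - 1; pose d2 := n - j - l - 1.
pose bs := nseq i [::] ++ [:: nseq k (Some true)] ++ nseq d1 [::] ++
  [:: nseq l (Some true)] ++ nseq d2 [::].
have szb : size (join bs) = n.
  rewrite /bs !join_cat !join_nil !size_cat !size_nseq /= ?cats0 !size_rcons !size_nseq.
  by rewrite /d1 /d2; lia.
transitivity (\sum_(u in S | small u) matches (join bs) (bit u) 0).
  apply: eq_bigr => u _; congr nat_of_bool.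
  rewrite /bs !join_cat !join_nil !join1 !matches_cat !matches_block !matches_None !size_nseq !size_rcons.
  rewrite !size_nseq !matches_run andbT /=.
  by congr (_ && run _ _ _); rewrite /d1 /=; lia.
have cut g : 10 <= g -> nseq g ([::] : seq letter) = nseq 10 [::] ++ nseq (g - 10) [::].
  by move=> h10; rewrite -nseqD subnKC.
have : [|| 10 <= i, 10 <= d1 | 10 <= d2] by rewrite /d1 /d2; lia.
case/or3P => h10.
- have e1 : bs = [::] ++ nseq 10 [::] ++ nseq (i - 10) [::] ++
     [:: nseq k (Some true)] ++ nseq d1 [::] ++ [:: nseq l (Some true)] ++ nseq d2 [::].
    by rewrite /bs (cut i) // -!catA.
  rewrite e1; apply: (@sum_small _ _ _ (i - 10 + d1 + d2)); last by rewrite -e1 szb.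
  by perm_blocks.
- have e1 : bs = (nseq i [::] ++ [:: nseq k (Some true)]) ++ nseq 10 [::] ++
     nseq (d1 - 10) [::] ++ [:: nseq l (Some true)] ++ nseq d2 [::].
    by rewrite /bs (cut d1) // -!catA.
  rewrite e1; apply: (@sum_small _ _ _ (i + (d1 - 10) + d2)); last by rewrite -e1 szb.
  by perm_blocks.
- have e1 : bs = (nseq i [::] ++ [:: nseq k (Some true)] ++ nseq d1 [::] ++
     [:: nseq l (Some true)]) ++ nseq 10 [::] ++ nseq (d2 - 10) [::].
    by rewrite /bs (cut d2) // -!catA.
  rewrite e1; apply: (@sum_small _ _ _ (i + d1 + (d2 - 10))); last by rewrite -e1 szb.
  by perm_blocks.
Qed.

End Family.

(** * The size of the part with few ascents *)

Section IntegerCounts.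
Import GRing.Theory Num.Theory Order.TTheory.
Local Open Scope ring_scope.

Lemma sum_eq a c : \sum_(0 <= j < a) (c == j)%:R = (c < a)%N%:R :> int.
Proof.
elim: a => [|a IH]; first by rewrite big_nil.
by rewrite big_nat_recr //= IH -natrD; congr _%:R; lia.
Qed.

Lemma sum_eqS a c : \sum_(0 <= j < a) (c == j.+1)%:R = (0 < c <= a)%N%:R :> int.
Proof.
case: c => [|c]; first by rewrite big1.
by under eq_bigr do rewrite eqSS; rewrite sum_eq.
Qed.

Lemma sum_eqSS a c : \sum_(0 <= j < a) (c == j.+2)%:R = (1 < c <= a.+1)%N%:R :> int.
Proof.
case: c => [|[|c]]; try by rewrite big1.
by under eq_bigr do rewrite !eqSS; rewrite sum_eq.
Qed.

Lemma sum_eq' a c : \sum_(0 <= j < a) (j == c)%:R = (c < a)%N%:R :> int.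
Proof. by under eq_bigr do rewrite eq_sym; rewrite sum_eq. Qed.

Lemma sum_eqS' a c : \sum_(0 <= j < a) (j.+1 == c)%:R = (0 < c <= a)%N%:R :> int.
Proof. by under eq_bigr do rewrite eq_sym; rewrite sum_eqS. Qed.

Lemma sum_eqSS' a c : \sum_(0 <= j < a) (j.+2 == c)%:R = (1 < c <= a.+1)%N%:R :> int.
Proof. by under eq_bigr do rewrite eq_sym; rewrite sum_eqSS. Qed.

Definition sum_eqE := (sum_eq, sum_eqS, sum_eqSS, sum_eq', sum_eqS', sum_eqSS').

Lemma sum_lt a b : \sum_(0 <= i < a) (i < b)%N%:R = (minn a b)%:R :> int.
Proof.
elim: a => [|a IH]; first by rewrite big_nil min0n.
by rewrite big_nat_recr //= IH -natrD; congr _%:R; lia.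
Qed.

Lemma sum_ge a b : \sum_(0 <= i < a) (b <= i)%N%:R = (a - b)%N%:R :> int.
Proof.
elim: a => [|a IH]; first by rewrite big_nil sub0n.
by rewrite big_nat_recr //= IH -natrD; congr _%:R; lia.
Qed.

(** The coefficient of [s] exceeds the bound on [M], so [s = 0]. The remaining [q] units are then
    absorbed, using [q <= p + r]: a unit joined to [n - 1] gives [n], and a unit joined to
    [n(n-3)/2] gives [C(n-1,2)], where [n = k + 4]. *)
Lemma nonneg_decomposition (k M : nat) (p q r s z : int) : (M < k.+3 * k.+1)%N ->
  0 <= p -> 0 <= q -> 0 <= r -> 0 <= s -> 0 <= z -> 0 <= p - q + r + s ->
  2 * M%:Z = 2 * (k%:Z + 3) * p + 2 * q + (k%:Z + 4) * (k%:Z + 1) * r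
    + (k%:Z + 4) * (k%:Z + 3) * z + 2 * ((k%:Z + 4) * (k%:Z + 2) - 1) * s ->
  exists a b c d e : nat, (2 * M = 2 * k.+3 * a + 2 * k.+4 * b + k.+4 * k.+1 * c
     + k.+3 * k.+2 * d + k.+4 * k.+3 * e)%N.
Proof.
move=> Mlt p0 q0 r0 s0 z0 w0 ME.
have {}s0 : s = 0.
  case: (leP 1 s) => [s1|]; last lia.
  have h1 : 0 <= (k%:Z + 3) * p by rewrite mulr_ge0.
  have h2 : 0 <= (k%:Z + 4) * (k%:Z + 1) * r by rewrite !mulr_ge0.
  have h3 : 0 <= (k%:Z + 4) * (k%:Z + 3) * z by rewrite !mulr_ge0.
  have h4 : 0 <= ((k%:Z + 4) * (k%:Z + 2) - 1) * (s - 1).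
    by rewrite mulr_ge0 ?subr_ge0 //; lia.
  lia.
case: p q r z w0 ME p0 q0 r0 z0 => [p|//] [q|//] [r|//] [z|//] w0 ME _ _ _ _.
move: w0 ME; rewrite s0 mulr0 !addr0 => w0 ME.
case: (leqP q p) => qp.
  have [x e] : exists x, p = (x + q)%N by exists (p - q)%N; lia.
  by exists x, q, r, 0%N, z; rewrite e in ME; lia.
have [x e] : exists x, q = (p + x)%N by exists (q - p)%N; lia.
have [c e'] : exists c, r = (c + x)%N by exists (r - x)%N; lia.
exists 0%N, p, c, x, z; rewrite e e' in ME; lia.
Qed.

(** * Runs of ascents in a single 0/1 sequence *)

Section Runs.
Variables (f : nat -> bool) (k : nat).
Let m := k.+3.
Hypothesis no_triple : forall i j l, (i.+1 < j)%N -> (j.+1 < l)%N -> (l < m)%N ->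
  [&& f i, f j & f l] = false.

(** A run of length [l] contributes [l - (l - 1) = 1]. Being quadratic in the indicators, this form
    turns moments into sums of block counts. *)
Definition nruns : int := \sum_(0 <= j < m) (f j)%:R -
  \sum_(0 <= j < m.-1) (f j)%:R * (f j.+1)%:R.

Let start j := f j && ((j == 0%N) || ~~ f j.-1).

Let starts := [seq j <- iota 0 m | start j].

Lemma nruns_starts : nruns = (size starts)%:R.
Proof.
have -> : size starts = (\sum_(0 <= j < m) start j)%N.
  by rewrite size_filter -sumn_count /index_iota subn0 sumnE big_map.
rewrite /nruns /m [k.+3.-1]/=; elim: k.+2 => [|a IH].
  rewrite !big_nat1 big_nil subr0 /start /=; by rewrite andbT.
rewrite big_nat_recr //= [in X in _ - X]big_nat_recr //= [in RHS]big_nat_recr //=.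
rewrite natrD -IH /start /=.
move: (\sum_(0 <= i < a.+1) _) (\sum_(0 <= i < a) _) => A B.
case: (f a); case: (f a.+1); rewrite /= ?mulr1n ?mulr0n; lia.
Qed.

Let sorted_starts : sorted ltn starts.
Proof. by apply: sorted_filter; [exact: ltn_trans | exact: iota_ltn_sorted]. Qed.

Let mem_starts x : x \in starts -> start x /\ (x < m)%N.
Proof. by rewrite mem_filter mem_iota add0n leq0n => /andP. Qed.

Let two_starts : (1 < size starts)%N ->
  exists i j, [/\ (i < j)%N, (j < m)%N, start i & start j].
Proof.
have := sorted_starts; have := mem_starts.
case: starts => [|i [|j s]] // h /andP [ij _] _.
exists i, j; have [] := h i; first by rewrite inE eqxx.
by have [] := h j; first by rewrite !inE eqxx orbT.
Qed.

Let three_starts : (2 < size starts)%N ->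
  exists i j l, [/\ (i < j < l)%N, (l < m)%N, start i, start j & start l].
Proof.
have := sorted_starts; have := mem_starts.
case: starts => [|i [|j [|l s]]] // h /and3P [ij jl _] _.
exists i, j, l; have [] := h i; first by rewrite inE eqxx.
have [] := h j; first by rewrite !inE eqxx orbT.
have [] := h l; first by rewrite !inE eqxx !orbT.
by split=> //; apply/andP; split.
Qed.

Let start_gap i j : f i -> start j -> (i < j)%N -> (i.+1 < j)%N.
Proof.
move=> bi /andP [bj]; case: j bj => // j _ /= nj; rewrite !ltnS leq_eqVlt => /orP [/eqP ij|//].
by rewrite -ij bi in nj.
Qed.

(** The least ascent starts a run, and the starts of three runs would be pairwise nonadjacent
    ascents. *)
Lemma nruns_1_or_2 j0 : (j0 < m)%N -> f j0 -> nruns = 1 \/ nruns = 2.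
Proof.
move=> j0m bj0; rewrite nruns_starts.
have pos : (0 < size starts)%N.
  have ex : exists j, f j by exists j0.
  case: (ex_minnP ex) => i bi mini.
  have iin : i \in starts.
    rewrite mem_filter mem_iota /start bi /= add0n (leq_ltn_trans (mini _ bj0) j0m) andbT.
    case: i bi mini => // i _ mini /=; apply/negP => /mini; lia.
  by case: starts iin.
have le2 : (size starts <= 2)%N.
  rewrite leqNgt; apply/negP => /three_starts [i [j [l [/andP [ij jl] lm si sj sl]]]].
  have [/andP [bi _] /andP [bj _] /andP [bl _]] := And3 si sj sl.
  have := no_triple (start_gap bi sj ij) (start_gap bj sl jl) lm.
  by rewrite bi bj bl.
by case: (size starts) pos le2 => [|[|[|]]] // _ _; [left | right].
Qed.

(** Otherwise let [a < b] start two runs. If [b <= i], then [a], [b], [i+2] are pairwise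
    nonadjacent; if [b > i+3], then [i], [i+2], [b] are; and [i+1], [i+2], [i+3] follow an ascent,
    so none of them is a start. *)
Lemma nruns_run3 i : (i.+2 < m)%N -> f i -> f i.+1 -> f i.+2 -> nruns = 1.
Proof.
move=> im b0 b1 b2; case: (nruns_1_or_2 im b2) => // r2.
have /two_starts [a [b [ab bm sa sb]]] : (1 < size starts)%N.
  by move: r2; rewrite nruns_starts; lia.
have [ba _] := andP sa; have [bb _] := andP sb.
have ab2 := start_gap ba sb ab.
have nb x : f x -> b = x.+1 -> False by move=> bx e; have := start_gap bx sb; lia.
have f1 : (b < i)%N -> False.
  move=> bi; have := @no_triple a b i.+2 ab2; rewrite ba bb b2; lia.
have f2 : b = i -> False.
  move=> bi; have := @no_triple a i i.+2; rewrite ba b0 b2; lia.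
have f3 : (i.+3 < b)%N -> False.
  move=> bi; have := @no_triple i i.+2 b; rewrite b0 b2 bb; lia.
have := nb _ b0; have := nb _ b1; have := nb _ b2; lia.
Qed.

End Runs.

(** * Moments of the number of runs over the small members *)

Section Small.
Variables (T : finType) (S : {set T}) (bit : T -> nat -> bool) (k : nat).
Let n := k.+4.
Let m := k.+3.
Hypothesis exch : exchangeable S bit n.
Hypothesis n52 : (52 <= n)%N.
Hypothesis cardS : (#|S| < (n - 1) * (n - 3))%N.
Hypothesis nonconst : forall u, u \in S -> exists2 j, (j < m)%N & bit u j.

Let E (f : T -> int) : int := \sum_(u in S | small bit u) f u.
Let X u j : int := (bit u j)%:R.
Let v (ks : seq nat) : int :=
  (small_count S bit [seq nseq k (Some true) | k <- ks])%:R.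

Let Ebool (b : T -> bool) c : (\sum_(u in S | small bit u) b u = c)%N ->
  E (fun u => (b u)%:R) = c%:R.
Proof. by move=> <-; rewrite natr_sum. Qed.

Let Erun i l : (i + l < n)%N -> (l <= 4)%N -> E (fun u => (run bit u i l)%:R) = v [:: l].
Proof. by move=> h1 h2; apply: Ebool; exact: (sum_run exch n52 cardS). Qed.

Let Erun2 i l j l' : (i + l < j)%N -> (j + l' < n)%N -> (l <= 4)%N -> (l' <= 4)%N ->
  E (fun u => (run bit u i l && run bit u j l')%:R) = v [:: l; l'].
Proof. by move=> *; apply: Ebool; exact: (sum_run2 exch n52 cardS). Qed.

(* Read by [lia] from the context, like [k48] below. *)
Let v12 : v [:: 1%N; 2%N] = v [:: 2%N; 1%N].
Proof.
congr _%:R; apply: eq_bigr => t _; apply: (matching_perm exch (e := 0) (e' := 0)).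
  by rewrite !cats0 perm_cat2l (perm_catC [:: _] [:: _]).
by rewrite join_cat size_cat size_join_sing size_tuple /=; lia.
Qed.

Let eqE (f g : T -> int) : (forall u, u \in S -> small bit u -> f u = g u) -> E f = E g.
Proof. by move=> fg; apply: eq_bigr => u /andP [? ?]; apply: fg. Qed.

Let v1 := v [:: 1%N].
Let v2 := v [:: 2%N].
Let v3 := v [:: 3%N].
Let v4 := v [:: 4%N].
Let v11 := v [:: 1%N; 1%N].
Let v21 := v [:: 2%N; 1%N].
Let v22 := v [:: 2%N; 2%N].

(** These give the value for distant positions, corrected by indicators for the few relative
    positions at which two blocks overlap or merge. In this form the sums over [j] are evaluated by
    [sum_eqE]. *)
Let fpp i j : int := v11 + (i == j)%:R * (v1 - v11) +
  ((i.+1 == j)%:R + (j.+1 == i)%:R) * (v2 - v11).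
Let fpq i j : int := v21 + ((i == j)%:R + (i == j.+1)%:R) * (v2 - v21) +
  ((i.+1 == j)%:R + (i == j.+2)%:R) * (v3 - v21).
Let fqq i j : int := v22 + (i == j)%:R * (v2 - v22) +
  ((i.+1 == j)%:R + (j.+1 == i)%:R) * (v3 - v22) +
  ((i.+2 == j)%:R + (j.+2 == i)%:R) * (v4 - v22).

Let boolM (a b : bool) : a%:R * b%:R = (a && b)%:R :> int.
Proof. by case: a; case: b. Qed.

Ltac eval_indicators f :=
  rewrite /f; repeat match goal with |- context [?a == ?b :> nat] =>
    first [have -> : (a == b :> nat) = true by lia | have -> : (a == b :> nat) = false by lia] end;
  rewrite /= ?mulr1n ?mulr0n ?mul0r ?mul1r ?addr0 ?add0r ?mul0r ?mul1r ?addr0.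
Let Epp i j : (i < m)%N -> (j < m)%N -> E (fun u => X u i * X u j) = fpp i j.
Proof.
move=> im jm; have [ij|[ij|[ij|[ij|ij]]]] :
    i = j \/ (j = i.+1 \/ (i = j.+1 \/ (i.+1 < j \/ j.+1 < i)))%N by lia.
- rewrite -ij; eval_indicators fpp; rewrite -[LHS](@eqE (fun u => (run bit u i 1)%:R)) ?Erun /n; try lia.
  by move=> u _ _; rewrite /X boolM andbb /run /= andbT.
- rewrite ij; eval_indicators fpp; rewrite -[LHS](@eqE (fun u => (run bit u i 2)%:R)) ?Erun /n; try lia.
  by move=> u _ _; rewrite /X boolM /run /= andbT.
- rewrite ij; eval_indicators fpp; rewrite -[LHS](@eqE (fun u => (run bit u j 2)%:R)) ?Erun /n; try lia.
  by move=> u _ _; rewrite /X boolM /run /= andbT andbC.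
- eval_indicators fpp; rewrite -[LHS](@eqE (fun u => (run bit u i 1 && run bit u j 1)%:R)) ?Erun2 /n; try lia.
  by move=> u _ _; rewrite /X boolM /run /= !andbT.
- eval_indicators fpp; rewrite -[LHS](@eqE (fun u => (run bit u j 1 && run bit u i 1)%:R)) ?Erun2 /n; try lia.
  by move=> u _ _; rewrite /X boolM /run /= !andbT andbC.
Qed.

Let Epq i j : (i < m)%N -> (j.+1 < m)%N ->
  E (fun u => X u i * (X u j * X u j.+1)) = fpq i j.
Proof.
move=> im jm; have [ij|[ij|[ij|[ij|[ij|ij]]]]] :
    i = j \/ (i = j.+1 \/ (j = i.+1 \/ (i = j.+2 \/ (i.+1 < j \/ j.+2 < i))))%N by lia.
- rewrite -ij; eval_indicators fpq; rewrite -[LHS](@eqE (fun u => (run bit u i 2)%:R)) ?Erun /n; try lia.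
  by move=> u _ _; rewrite /X !boolM /run /= andbT; case: (bit u i).
- rewrite ij; eval_indicators fpq; rewrite -[LHS](@eqE (fun u => (run bit u j 2)%:R)) ?Erun /n; try lia.
  by move=> u _ _; rewrite /X !boolM /run /= andbT; case: (bit u j); case: (bit u _).
- rewrite ij; eval_indicators fpq; rewrite -[LHS](@eqE (fun u => (run bit u i 3)%:R)) ?Erun /n; try lia.
  by move=> u _ _; rewrite /X !boolM /run /= andbT.
- rewrite ij; eval_indicators fpq; rewrite -[LHS](@eqE (fun u => (run bit u j 3)%:R)) ?Erun /n; try lia.
  by move=> u _ _; rewrite /X !boolM /run /= andbT andbA andbC.
- eval_indicators fpq; rewrite -[LHS](@eqE (fun u => (run bit u i 1 && run bit u j 2)%:R)) ?Erun2 /n; try lia.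
  by move=> u _ _; rewrite /X !boolM /run /= !andbT.
- eval_indicators fpq; rewrite -[LHS](@eqE (fun u => (run bit u j 2 && run bit u i 1)%:R)) ?Erun2 /n; try lia.
  by move=> u _ _; rewrite /X !boolM /run /= !andbT andbC.
Qed.

Let Eqq i j : (i.+1 < m)%N -> (j.+1 < m)%N ->
  E (fun u => X u i * X u i.+1 * (X u j * X u j.+1)) = fqq i j.
Proof.
move=> im jm; have [ij|[ij|[ij|[ij|[ij|[ij|ij]]]]]] :
    i = j \/ (i = j.+1 \/ (j = i.+1 \/ (i = j.+2 \/ (j = i.+2 \/ (i.+2 < j \/ j.+2 < i)))))%N by lia.
- rewrite -ij; eval_indicators fqq; rewrite -[LHS](@eqE (fun u => (run bit u i 2)%:R)) ?Erun /n; try lia.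
  by move=> u _ _; rewrite /X !boolM /run /= andbT andbb.
- rewrite ij; eval_indicators fqq; rewrite -[LHS](@eqE (fun u => (run bit u j 3)%:R)) ?Erun /n; try lia.
  by move=> u _ _; rewrite /X !boolM /run /= andbT; do 3 case: (bit u _).
- rewrite ij; eval_indicators fqq; rewrite -[LHS](@eqE (fun u => (run bit u i 3)%:R)) ?Erun /n; try lia.
  by move=> u _ _; rewrite /X !boolM /run /= andbT; do 3 case: (bit u _).
- rewrite ij; eval_indicators fqq; rewrite -[LHS](@eqE (fun u => (run bit u j 4)%:R)) ?Erun /n; try lia.
  by move=> u _ _; rewrite /X !boolM /run /= andbT; do 4 case: (bit u _).
- rewrite ij; eval_indicators fqq; rewrite -[LHS](@eqE (fun u => (run bit u i 4)%:R)) ?Erun /n; try lia.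
  by move=> u _ _; rewrite /X !boolM /run /= andbT; do 4 case: (bit u _).
- eval_indicators fqq; rewrite -[LHS](@eqE (fun u => (run bit u i 2 && run bit u j 2)%:R)) ?Erun2 /n; try lia.
  by move=> u _ _; rewrite /X !boolM /run /= !andbT.
- eval_indicators fqq; rewrite -[LHS](@eqE (fun u => (run bit u j 2 && run bit u i 2)%:R)) ?Erun2 /n; try lia.
  by move=> u _ _; rewrite /X !boolM /run /= !andbT andbC.
Qed.

Let no_triple u i j l : u \in S -> small bit u -> (i.+1 < j)%N -> (j.+1 < l)%N -> (l < m)%N ->
  [&& bit u i, bit u j & bit u l] = false.
Proof. by move=> uS su ij jl lm; apply: (small_no_triple exch n52 cardS uS su ij jl). Qed.

Let r u := nruns (bit u) k.

Let r12 u : u \in S -> small bit u -> r u = 1 \/ r u = 2.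
Proof.
move=> uS su; have [j jm bj] := nonconst uS.
by apply: (nruns_1_or_2 _ jm bj) => *; apply: no_triple.
Qed.

Let r_run3 u i : u \in S -> small bit u -> (i.+2 < m)%N ->
  bit u i -> bit u i.+1 -> bit u i.+2 -> r u = 1.
Proof. by move=> uS su im; apply: nruns_run3 => // *; apply: no_triple. Qed.

Let Eadd f g : E (fun u => f u + g u) = E f + E g.
Proof. exact: big_split. Qed.

Let Esub f g : E (fun u => f u - g u) = E f - E g.
Proof. exact: sumrB. Qed.

Let Eopp f : E (fun u => - f u) = - E f.
Proof. by rewrite /E sumrN. Qed.

Let Escale c f : E (fun u => c * f u) = c * E f.
Proof. by rewrite /E mulr_sumr. Qed.

Let Esum a (g : T -> nat -> int) :
  E (fun u => \sum_(0 <= j < a) g u j) = \sum_(0 <= j < a) E (fun u => g u j).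
Proof. exact: exchange_big. Qed.

Let Ege0 f : (forall u, u \in S -> small bit u -> 0 <= f u) -> 0 <= E f.
Proof. by move=> h; apply: sumr_ge0 => u /andP [? ?]; apply: h. Qed.

Let K : int := k%:R.

(** Closed form of the sum of [X_i r], established in [EXr]; [H] plays the same part for
    [X_i X_(i+1) r] in [EXXr]. The indicators account for neighbours missing near the two ends. *)
Let A i : int := (K + 3) * v11 + (v1 - v11) + ((i < k.+2)%N%:R + (1 <= i)%N%:R) * (v2 - v11)
  - ((K + 2) * v21 + ((i < k.+2)%N%:R + (1 <= i)%N%:R) * (v2 - v21) +
     ((i < k.+1)%N%:R + (2 <= i)%N%:R) * (v3 - v21)).

Let H i : int := (K + 3) * v21 + 2 * (v2 - v21) + ((i < k.+1)%N%:R + (1 <= i)%N%:R) * (v3 - v21)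
  - ((K + 2) * v22 + (v2 - v22) + ((i < k.+1)%N%:R + (1 <= i)%N%:R) * (v3 - v22) +
     ((i < k)%N%:R + (2 <= i)%N%:R) * (v4 - v22)).

Let EXr i : (i < m)%N -> E (fun u => X u i * r u) = A i.
Proof.
move=> im.
rewrite (eqE (g := fun u => \sum_(0 <= j < m) X u i * X u j -
   \sum_(0 <= j < m.-1) X u i * (X u j * X u j.+1))); last first.
  by move=> u _ _; rewrite /r /nruns mulrBr !mulr_sumr.
rewrite Esub !Esum (eq_big_nat _ _ (F2 := fpp i)); last first.
  by move=> j /andP [_ jm]; apply: Epp.
rewrite [X in _ - X](eq_big_nat _ _ (F2 := fpq i)); last first.
  by move=> j /andP [_ jm]; apply: Epq.
rewrite /fpp /fpq !big_split /= -!mulr_suml !big_split /= !sum_eqE !sumr_const_nat.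
rewrite /A !subn0 /m ?[k.+3.-1]/=.
have -> : (i < k.+3)%N = true by lia.
have -> : (i.+1 < k.+3)%N = (i < k.+2)%N by lia.
have -> : (i.+1 < k.+2)%N = (i < k.+1)%N by lia.
have -> : (0 < i <= k.+3)%N = (0 < i)%N by lia.
have -> : (0 < i <= k.+2)%N = (0 < i)%N by lia.
have -> : (1 < i <= k.+3)%N = (1 < i)%N by lia.
by rewrite ?mulr1n /K; ring.
Qed.

Let EXXr i : (i < k.+2)%N -> E (fun u => X u i * X u i.+1 * r u) = H i.
Proof.
move=> im.
rewrite (eqE (g := fun u => \sum_(0 <= j < m) X u j * (X u i * X u i.+1) -
   \sum_(0 <= j < m.-1) X u i * X u i.+1 * (X u j * X u j.+1))); last first.
  move=> u _ _; rewrite /r /nruns mulrBr !mulr_sumr; congr (_ - _).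
  by apply: eq_bigr => j _; rewrite mulrC.
rewrite Esub !Esum (eq_big_nat _ _ (F2 := fpq^~ i)); last first.
  by move=> j /andP [_ jm]; apply: Epq.
rewrite [X in _ - X](eq_big_nat _ _ (F2 := fqq i)); last first.
  by move=> j /andP [_ jm]; apply: Eqq.
rewrite /fpq /fqq !big_split /= -!mulr_suml !big_split /= !sum_eqE !sumr_const_nat.
rewrite /H !subn0 /m ?[k.+3.-1]/=.
have -> : (i < k.+3)%N = true by lia.
have -> : (i.+1 < k.+3)%N = true by lia.
have -> : (i.+2 < k.+3)%N = (i < k.+1)%N by lia.
have -> : (i < k.+2)%N = true by lia.
have -> : (i.+1 < k.+2)%N = (i < k.+1)%N by lia.
have -> : (i.+2 < k.+2)%N = (i < k)%N by lia.
have -> : (0 < i <= k.+3)%N = (0 < i)%N by lia.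
have -> : (0 < i <= k.+2)%N = (0 < i)%N by lia.
have -> : (1 < i <= k.+3)%N = (1 < i)%N by lia.
by rewrite ?mulr1n /K; ring.
Qed.

Let EX i : (i < m)%N -> E (fun u => X u i) = v1.
Proof.
move=> im; rewrite /v1 -(Erun (i := i) (l := 1)) //; last by rewrite /n; lia.
by apply: eqE => u _ _; rewrite /X /run /= andbT.
Qed.

Let EXX i : (i.+1 < m)%N -> E (fun u => X u i * X u i.+1) = v2.
Proof.
move=> im; rewrite /v2 -(Erun (i := i) (l := 2)) //; last by rewrite /n; lia.
by apply: eqE => u _ _; rewrite /X boolM /run /= andbT.
Qed.

Let EXXX i : (i.+2 < m)%N -> E (fun u => X u i * X u i.+1 * X u i.+2) = v3.
Proof.
move=> im; rewrite /v3 -(Erun (i := i) (l := 3)) //; last by rewrite /n; lia.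
by apply: eqE => u _ _; rewrite /X !boolM /run /= andbT andbA.
Qed.

Let EXXXX i : (i.+3 < m)%N -> E (fun u => X u i * X u i.+1 * X u i.+2 * X u i.+3) = v4.
Proof.
move=> im; rewrite /v4 -(Erun (i := i) (l := 4)) //; last by rewrite /n; lia.
by apply: eqE => u _ _; rewrite /X !boolM /run /= andbT !andbA.
Qed.

Let k48 : (48 <= k)%N. Proof. by move: n52; rewrite /n; lia. Qed.

(* The numbers of members whose set of ascents is, respectively, exactly the first position, an
   interior position, an interior pair of neighbours, two distant interior positions, an interior
   position together with a distant pair. *)
Let a1 := 2 * v1 - A 0 - 2 * v2 + H 0.
Let a3 := 2 * v1 - A 3 - 2 * v2 + H 2 - 2 * v2 + H 3 + v3.
Let b2 := 2 * v2 - H 2 - v3 - v3 + v4.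
Let t := v11 - v21 - v21 - v21 - v21 + v22 + v22 + v22 + v22.
Let y := v21 - v22 - v22.

(** The summand is [X_0 (1 - X_1) (2 - r)], and [r] is at most 2. *)
Let a1_ge0 : 0 <= a1.
Proof.
have -> : a1 = E (fun u => 2 * X u 0 - X u 0 * r u - 2 * (X u 0 * X u 1) + X u 0 * X u 1 * r u).
  by rewrite !Eadd !Eopp !Escale EX // EXX // EXr // EXXr.
apply: Ege0 => u uS su; rewrite /X; case: (r12 uS su) => ->;
  case: (bit u 0); case: (bit u 1); rewrite /= ?mulr1n ?mulr0n; lia.
Qed.

(** The summand is [X_3 (1 - X_2) (1 - X_4) (2 - r)], its last product being simplified by [r = 1]
    on a run of three ascents. *)
Let a3_ge0 : 0 <= a3.
Proof.
have -> : a3 = E (fun u => 2 * X u 3 - X u 3 * r u - 2 * (X u 2 * X u 3) + X u 2 * X u 3 * r u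
   - 2 * (X u 3 * X u 4) + X u 3 * X u 4 * r u + X u 2 * X u 3 * X u 4).
  rewrite !Eadd !Eopp !Escale EX ?(@EXX 2) ?(@EXX 3) ?EXr ?(@EXXr 2) ?(@EXXr 3) ?(@EXXX 2) //;
  rewrite /m; lia.
apply: Ege0 => u uS su; have := @r_run3 u 2 uS su; rewrite /X.
case: (r12 uS su) => ->;
  case: (bit u 2); case: (bit u 3); case: (bit u 4) => h; rewrite /= ?mulr1n ?mulr0n; lia.
Qed.

(** The summand is [X_2 X_3 (1 - X_1) (1 - X_4) (2 - r)], simplified in the same way. *)
Let b2_ge0 : 0 <= b2.
Proof.
have -> : b2 = E (fun u => 2 * (X u 2 * X u 3) - X u 2 * X u 3 * r u
   - X u 1 * X u 2 * X u 3 - X u 2 * X u 3 * X u 4 + X u 1 * X u 2 * X u 3 * X u 4).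
  rewrite !Eadd !Eopp !Escale ?(@EXX 2) ?(@EXXr 2) ?(@EXXX 1) ?(@EXXX 2) ?(@EXXXX 1) //;
  rewrite /m; lia.
apply: Ege0 => u uS su; have := @r_run3 u 2 uS su; have := @r_run3 u 1 uS su; rewrite /X.
case: (r12 uS su) => ->; case: (bit u 1);
  case: (bit u 2); case: (bit u 3); case: (bit u 4) => h h'; rewrite /= ?mulr1n ?mulr0n; lia.
Qed.

Let EpqG i j : (i < m)%N -> (j.+1 < m)%N -> (i.+1 < j)%N || (j.+2 < i)%N ->
  E (fun u => X u i * (X u j * X u j.+1)) = v21.
Proof. by move=> im jm ij; rewrite Epq //; eval_indicators fpq. Qed.

Let EqqG i j : (i.+1 < m)%N -> (j.+1 < m)%N -> (i.+2 < j)%N ->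
  E (fun u => X u i * X u i.+1 * (X u j * X u j.+1)) = v22.
Proof. by move=> im jm ij; rewrite Eqq //; eval_indicators fqq. Qed.

(** The summand is [X_1 (1 - X_0) (1 - X_2) X_5 (1 - X_4) (1 - X_6)] without the products that
    contain three pairwise nonadjacent ascents, since these vanish. *)
Let t_ge0 : 0 <= t.
Proof.
have -> : t = E (fun u => X u 1 * X u 5 - X u 5 * (X u 0 * X u 1) - X u 5 * (X u 1 * X u 2)
   - X u 1 * (X u 4 * X u 5) - X u 1 * (X u 5 * X u 6)
   + X u 0 * X u 1 * (X u 4 * X u 5) + X u 0 * X u 1 * (X u 5 * X u 6)
   + X u 1 * X u 2 * (X u 4 * X u 5) + X u 1 * X u 2 * (X u 5 * X u 6)).
  rewrite !Eadd !Eopp Epp /m ?(@EpqG 5 0) ?(@EpqG 5 1) ?(@EpqG 1 4) ?(@EpqG 1 5)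
   ?(@EqqG 0 4) ?(@EqqG 0 5) ?(@EqqG 1 4) ?(@EqqG 1 5) /m //; try lia.
  by rewrite /fpp /= !mulr0n !mul0r !addr0.
apply: Ege0 => u uS su.
have := @no_triple u 0 2 5 uS su; have := @no_triple u 1 4 6 uS su; rewrite /X.
case: (bit u 0); case: (bit u 1); case: (bit u 2); case: (bit u 4); case: (bit u 5);
  case: (bit u 6) => h h'; rewrite /= ?mulr1n ?mulr0n; lia.
Qed.

(** The summand is [X_0 X_1 X_4 (1 - X_3) (1 - X_5)], the product with [X_3 X_4 X_5] vanishing
    because of the ascents 1, 3, 5. *)
Let y_ge0 : 0 <= y.
Proof.
have -> : y = E (fun u => X u 4 * (X u 0 * X u 1) - X u 0 * X u 1 * (X u 3 * X u 4)
   - X u 0 * X u 1 * (X u 4 * X u 5)).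
  rewrite !Eadd !Eopp ?(@EpqG 4 0) ?(@EqqG 0 3) ?(@EqqG 0 4) /m //; lia.
apply: Ege0 => u uS su; have := @no_triple u 1 3 5 uS su; rewrite /X.
case: (bit u 0); case: (bit u 1); case: (bit u 3); case: (bit u 4);
  case: (bit u 5) => h; rewrite /= ?mulr1n ?mulr0n; lia.
Qed.

Let v22_ge0 : 0 <= v22. Proof. exact: ler0n. Qed.

Let sumA : \sum_(0 <= i < m) A i = (K + 3) * ((K + 3) * v11 + (v1 - v11) - (K + 2) * v21)
  + 2 * (K + 2) * (v2 - v11) - 2 * (K + 2) * (v2 - v21) - 2 * (K + 1) * (v3 - v21).
Proof.
rewrite /A sumrB !big_split /= -!mulr_suml !big_split /= !sum_lt !sum_ge !sumr_const_nat.
rewrite /m !subn0 !subSS !subn0; have -> : minn k.+3 k.+2 = k.+2 by lia.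
have -> : minn k.+3 k.+1 = k.+1 by lia.
by rewrite /K; ring.
Qed.

Let sumH : \sum_(0 <= i < m.-1) H i = (K + 2) * ((K + 3) * v21 + 2 * (v2 - v21)
   - (K + 2) * v22 - (v2 - v22))
  + 2 * (K + 1) * (v3 - v21) - 2 * (K + 1) * (v3 - v22) - 2 * K * (v4 - v22).
Proof.
rewrite /H sumrB !big_split /= -!mulr_suml !big_split /= !sum_lt !sum_ge !sumr_const_nat.
rewrite ?subn0 !subSS ?subn0; have -> : minn k.+2 k.+1 = k.+1 by lia.
have -> : minn k.+2 k = k by lia.
by rewrite /K; ring.
Qed.

Let Er : E r = (K + 3) * v1 - (K + 2) * v2.
Proof.
rewrite -[LHS](@eqE (fun u => \sum_(0 <= j < m) X u j - \sum_(0 <= j < m.-1) X u j * X u j.+1)) //.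
rewrite Esub !Esum (eq_big_nat _ _ (F2 := fun=> v1)); last by move=> j /andP [_ /EX].
rewrite [X in _ - X](eq_big_nat _ _ (F2 := fun=> v2)); last by move=> j /andP [_ jm]; apply: EXX.
by rewrite !sumr_const_nat !subn0 /m /=; rewrite /K; ring.
Qed.

Let Err : E (fun u => r u * r u) = \sum_(0 <= i < m) A i - \sum_(0 <= i < m.-1) H i.
Proof.
rewrite (@eqE _ (fun u => \sum_(0 <= j < m) X u j * r u
   - \sum_(0 <= j < m.-1) X u j * X u j.+1 * r u)); last first.
  by move=> u _ _; rewrite {1}/r /nruns mulrBl !mulr_suml.
rewrite Esub !Esum (eq_big_nat _ _ (F2 := A)); last by move=> j /andP [_ /EXr].
by rewrite [X in _ - X](eq_big_nat _ _ (F2 := H)) // => j /andP [_ jm]; apply: EXXr.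
Qed.

Let N : int := #|[set u in S | small bit u]|%:R.

(** Since [r] is 1 or 2, [(r - 1) (r - 2) = 0], that is [3 r - r^2 = 2]. *)
Let N_E : 2 * N = 3 * E r - E (fun u => r u * r u).
Proof.
rewrite -Escale -Esub (@eqE _ (fun=> 2)); last first.
  by move=> u uS su; case: (r12 uS su) => ->.
rewrite /E sumr_const /N mulr_natr; congr (_ *+ _).
by apply: eq_card => u; rewrite !inE.
Qed.

Let N_decomposition : 2 * N = 2 * (K + 3) * a1 + 2 * b2 + (K + 4) * (K + 1) * t
  + (K + 4) * (K + 3) * v22 + 2 * ((K + 4) * (K + 2) - 1) * y.
Proof.
rewrite N_E Er Err sumA sumH /a1 /b2 /t /y /A /H.
have -> : (2 < k.+1)%N = true by lia.
have -> : (2 < k)%N = true by lia.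
have -> : (0 < k)%N = true by lia.
by rewrite /= ?mulr1n ?mulr0n; ring.
Qed.

(** With [a3_ge0] this gives the inequality among the counts that [nonneg_decomposition]
    requires. *)
Let a3E : a3 = a1 - b2 + t + y.
Proof.
rewrite /a3 /a1 /b2 /t /y /A /H.
have -> : (3 < k.+2)%N = true by lia.
have -> : (2 < k.+1)%N = true by lia.
have -> : (3 < k.+1)%N = true by lia.
have -> : (2 < k)%N = true by lia.
have -> : (0 < k)%N = true by lia.
have -> : (3 < k)%N = true by lia.
by rewrite /= ?mulr1n ?mulr0n; ring.
Qed.

Lemma small_size : exists a b c d e : nat,
  (2 * #|[set u in S | small bit u]| = 2 * k.+3 * a + 2 * k.+4 * b + k.+4 * k.+1 * c
     + k.+3 * k.+2 * d + k.+4 * k.+3 * e)%N.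
Proof.
have Nlt : (#|[set u in S | small bit u]| < k.+3 * k.+1)%N.
  apply: leq_ltn_trans cardS; apply: subset_leq_card.
  by apply/subsetP => u; rewrite inE => /andP [].
apply: (nonneg_decomposition Nlt a1_ge0 b2_ge0 t_ge0 y_ge0 v22_ge0); first by rewrite -a3E.
by have := N_decomposition; rewrite /N /K !natz.
Qed.

End Small.

Lemma small_neg (T : finType) (bit : T -> nat -> bool) u :
  small (fun u j => ~~ bit u j) u = ~~ small bit u.
Proof.
rewrite /small -ltnNge.
have -> : win (fun u j => ~~ bit u j) u 0 = map negb (win bit u 0).
  by rewrite /win -!lock /mkseq -map_comp.
by rewrite count_map (count_negb_win bit); have := count_size id (win bit u 0); rewrite size_win; lia.
Qed.

Lemma size_decomposition (T : finType) (S : {set T}) (bit : T -> nat -> bool) (k : nat) :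
  exchangeable S bit k.+4 -> (52 <= k.+4)%N -> (#|S| < k.+3 * k.+1)%N ->
  (forall u, u \in S -> exists2 j, (j < k.+3)%N & bit u j) ->
  (forall u, u \in S -> exists2 j, (j < k.+3)%N & ~~ bit u j) ->
  exists a b c d e : nat, (2 * #|S| = 2 * k.+3 * a + 2 * k.+4 * b + k.+4 * k.+1 * c
     + k.+3 * k.+2 * d + k.+4 * k.+3 * e)%N.
Proof.
move=> exch n52; rewrite -[k.+3 in X in X -> _]/(k.+4 - 1)%N -[k.+1 in X in X -> _]/(k.+4 - 3)%N => cS nA nD.
have [a [b [c [d [e E1]]]]] := small_size exch n52 cS nA.
have [a' [b' [c' [d' [e' E2]]]]] := small_size (exchangeable_neg exch) n52 cS nD.
exists (a + a')%N, (b + b')%N, (c + c')%N, (d + d')%N, (e + e')%N.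
have -> : #|S| = (#|[set u in S | small bit u]| +
    #|[set u in S | small (fun u j => ~~ bit u j) u]|)%N.
  rewrite -(cardsID [set u | small bit u] S); congr (_ + _)%N.
    by apply: eq_card => u; rewrite !inE.
  by apply: eq_card => u; rewrite !inE small_neg andbC.
by rewrite mulnDr E1 E2; lia.
Qed.

End IntegerCounts.

(** * Necessity *)

Lemma increasing_id n (f : nat -> nat) : (forall i, i < n -> f i < n) ->
  (forall i, i.+1 < n -> f i < f i.+1) -> forall i, i < n -> f i = i.
Proof.
move=> fn fS i lt_in; apply/eqP; rewrite eqn_leq; apply/andP; split.
  have [d e] : exists d, i + d.+1 = n by exists (n - i.+1); lia.
  elim: d i e {lt_in} => [|d IH] i e; first by have := fn i; lia.
  by have := IH i.+1; have := fS i; lia.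
elim: i lt_in => // i IH lt_in; have := fS i lt_in; have := IH (ltnW lt_in); lia.
Qed.

Lemma pvalE n (u : {perm 'I_n}) (j : 'I_n) : Defs.pval u (val j).+1 = (val (u j)).+1.
Proof.
by rewrite /Defs.pval /oneline /= (nth_map j) ?size_enum_ord // nth_ord_enum.
Qed.

Lemma OrdinalE n j (hj : j < n.+1) : Ordinal hj = inord j.
Proof. by apply: val_inj; rewrite /= inordK. Qed.

Lemma DesE n (u : {perm 'I_n}) j (hj : j < n) (hj' : j.+1 < n) :
  (j.+1 \in Des u) = (u (Ordinal hj') < u (Ordinal hj)).
Proof.
rewrite inE /= hj' /= (pvalE u (Ordinal hj)).
by rewrite (pvalE u (Ordinal hj')).
Qed.

Lemma perm_val_id n (u : {perm 'I_n}) : (forall i : 'I_n, val (u i) = val i) -> u = 1%g.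
Proof. by move=> h; apply/permP => i; rewrite perm1; apply: val_inj. Qed.

Lemma noDes_iota n (u : {perm 'I_n}) : (forall j, j < n.-1 -> noDes u j) -> u = iota_perm n.
Proof.
move=> h; apply: perm_val_id => i; case: n u h i => [|n] u h i; first by case: i.
pose f j := val (u (inord j)).
have := @increasing_id n.+1 f _ _ i (ltn_ord i); rewrite /f inord_val; apply.
  by move=> j _; apply: ltn_ord.
move=> j hj; have hj' : j < n.+1 by lia.
have := h j hj; rewrite /noDes (DesE u hj' hj) -leqNgt leq_eqVlt => /orP [/eqP e|].
  by have /perm_inj /(congr1 val) /= := val_inj e; lia.
by rewrite !OrdinalE.
Qed.

Lemma allDes_delta n (u : {perm 'I_n}) :
  (forall j, j < n.-1 -> ~~ noDes u j) -> u = delta_perm n.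
Proof.
move=> h; apply/permP => i; rewrite permE; apply: val_inj.
case: n u h i => [|n] u h i; first by case: i.
pose f j := n - val (u (inord j)).
have := @increasing_id n.+1 f _ _ i (ltn_ord i); rewrite /f inord_val /=.
have := ltn_ord (u i); have := ltn_ord i => hi hu H.
suff : n - u i = i by lia.
apply: H => [j _|j hj]; first by lia.
have hj' : j < n.+1 by lia.
have := h j hj; rewrite /noDes negbK (DesE u hj' hj).
rewrite !OrdinalE.
by have := ltn_ord (u (inord j)); lia.
Qed.

(** The bound on [q] follows from the size: [q >= n - 3] would give
    [p >= q (n-1) >= (n-3) (n-1)]. *)
Lemma cond1_intro n p q r : 52 <= n -> p < (n - 1) * (n - 3) ->
  r <= q -> p + r = q * n -> cond1 n p.
Proof.
move=> n52 hp rq e; exists q, r; split=> //; rewrite ltnNge; apply/negP => hq.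
have := leq_mul hq (leqnn (n - 1)); rewrite mulnBr; nia.
Qed.

Lemma half_even j : (j.*2.+4 * (j.*2.+4 - 3)) %/ 2 = j.+2 * j.*2.+1.
Proof. by rewrite (_ : _ - 3 = j.*2.+1) // (_ : j.*2.+4 = 2 * j.+2) -?mulnA ?mulKn //; lia. Qed.

Lemma bin2_odd j : 'C(j.*2.+1.+4 - 1, 2) = j.+2 * j.*2.+3.
Proof. by rewrite subn1 bin2 -[j.*2.+1.+4.-1]/(j.+2.*2) -doubleMl doubleK. Qed.

Lemma size_conditions k p a b c d e : 52 <= k.+4 -> p < k.+3 * k.+1 ->
  2 * p = 2 * k.+3 * a + 2 * k.+4 * b + k.+4 * k.+1 * c + k.+3 * k.+2 * d + k.+4 * k.+3 * e ->
  [\/ cond1 k.+4 p, cond2 k.+4 p | cond3 k.+4 p].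
Proof.
move=> n52 hp E.
(* Two of the quadratic terms would already give [p >= n(n-3)], which is too large. *)
have small : c + d + e <= 1.
  rewrite leqNgt; apply/negP => h.
  have h1 : k.+4 * k.+1 * 2 <= k.+4 * k.+1 * (c + d + e) by rewrite leq_mul2l h orbT.
  have h2 : k.+4 * k.+1 * d <= k.+3 * k.+2 * d by rewrite leq_mul2r; apply/orP; right; lia.
  have h3 : k.+4 * k.+1 * e <= k.+4 * k.+3 * e by rewrite leq_mul2r; apply/orP; right; lia.
  move: h1; rewrite !mulnDr; lia.
have intro1 q r : r <= q -> p + r = q * k.+4 -> [\/ cond1 k.+4 p, cond2 k.+4 p | cond3 k.+4 p].
  by move=> rq pq; apply: Or31; apply: cond1_intro rq pq => //; rewrite subn1 (_ : k.+4 - 3 = k.+1).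
have cases : (c = 0 /\ d = 0 /\ e = 0) \/ (c = 1 /\ d = 0 /\ e = 0) \/
    (c = 0 /\ d = 1 /\ e = 0) \/ (c = 0 /\ d = 0 /\ e = 1) by lia.
have [j [kj|kj]] : exists j, k = j.*2 \/ k = j.*2.+1.
  by exists k./2; case: (boolP (odd k)) => o; [right|left]; lia.
- subst k; case: cases => [[? [? ?]]|[[? [? ?]]|[[? [? ?]]|[? [? ?]]]]]; subst c d e.
  + by apply: (intro1 (a + b) a); lia.
  (* For even [n], [n(n-3)/2 = (n/2 - 1) n - n/2] violates [r <= q] by exactly one. A summand [n]
     repairs this; without one, the second condition holds. *)
  + case: b E => [|b] E; last by apply: (intro1 (a + b + j.+2) (a + j.+2)); lia.
    apply: Or32; split; first by rewrite /= odd_double.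
    by exists a; rewrite half_even subn1 /=; lia.
  + by apply: (intro1 (a + b + j.+1) (a + j.+1)); lia.
  + by apply: (intro1 (a + b + j.+2) (a + j.+2)); lia.
- subst k; case: cases => [[? [? ?]]|[[? [? ?]]|[[? [? ?]]|[? [? ?]]]]]; subst c d e.
  + by apply: (intro1 (a + b) a); lia.
  + by apply: (intro1 (a + b + j.+1) a); lia.
  (* For odd [n], [C(n-1,2)] is one more than a multiple of [n]. A summand [n - 1] completes it to a
     multiple of [n]; without one, the third condition holds. *)
  + case: a E => [|a] E; last by apply: (intro1 (a + b + j.+2) a); lia.
    apply: Or33; split; first by rewrite /= odd_double.
    by exists b; rewrite bin2_odd; lia.
  + by apply: (intro1 (a + b + j.+2) a); lia.
Qed.

(** Modulo [n - 1], the first condition gives the residue [q - r], between 0 and [n - 4], and the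
    second gives [-1]. *)
Lemma not_cond12 n p : 52 <= n -> cond1 n p -> cond2 n p -> False.
Proof.
move=> n52 [q [r [rq qn pq]]] [on [c pc]].
have [j hj] : exists j, n = j.*2.+4 by exists (n./2 - 2); lia.
subst n; move: pc; rewrite half_even subn1 /= => pc.
have e1 : q * j.*2.+3 + (q - r) + 1 = (j + c + 1) * j.*2.+3 by lia.
case: (leqP (j + c + 1) q) => h.
  by have h1 : (j + c + 1) * j.*2.+3 <= q * j.*2.+3; [rewrite leq_mul2r h orbT | lia].
by have h1 : q.+1 * j.*2.+3 <= (j + c + 1) * j.*2.+3; [rewrite leq_mul2r h orbT | lia].
Qed.

(** Modulo [n], the first condition gives [-r] with [0 <= r < n - 3], and the third gives 1. *)
Lemma not_cond13 n p : 52 <= n -> cond1 n p -> cond3 n p -> False.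
Proof.
move=> n52 [q [r [rq qn pq]]] [on [c pc]].
have [j hj] : exists j, n = j.*2.+1.+4 by exists (n./2 - 2); lia.
subst n; move: pc; rewrite bin2_odd => pc.
have e1 : q * j.*2.+1.+4 = (j + c + 1) * j.*2.+1.+4 + r.+1 by lia.
case: (leqP q (j + c + 1)) => h.
  by have h1 : q * j.*2.+1.+4 <= (j + c + 1) * j.*2.+1.+4; [rewrite leq_mul2r h orbT | lia].
by have h1 : (j + c + 1).+1 * j.*2.+1.+4 <= q * j.*2.+1.+4; [rewrite leq_mul2r h orbT | lia].
Qed.

Lemma forward n p (S : {set {perm 'I_n}}) : 52 <= n -> p < (n - 1) * (n - 3) ->
  symmetric_set S -> #|S| = p -> iota_perm n \notin S -> delta_perm n \notin S ->
  [\/ cond1 n p, cond2 n p | cond3 n p].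
Proof.
case: n S => [|[|[|[|k]]]] // S n52; rewrite subn1 (_ : k.+4 - 3 = k.+1) //= => hp sym cS nI nD.
have [|||||a [b [c [d [e E]]]]] := @size_decomposition _ S (@noDes k.+4) k.
- exact: symmetric_exchangeable.
- by [].
- by rewrite cS.
- move=> u uS; case: (pickP (fun j : 'I_k.+3 => noDes u j)) => [j hj|h].
    by exists (val j); [exact: ltn_ord | exact: hj].
  case/negP: nD; rewrite -(allDes_delta (u := u)) // => j hj.
  by have := h (Ordinal hj) => /= ->.
- move=> u uS; case: (pickP (fun j : 'I_k.+3 => ~~ noDes u j)) => [j hj|h].
    by exists (val j); [exact: ltn_ord | exact: hj].
  case/negP: nI; rewrite -(noDes_iota (u := u)) // => j hj.
  by have /negbFE := h (Ordinal hj).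
by apply: (size_conditions n52 hp (a := a) (b := b) (c := c) (d := d) (e := e)); rewrite -cS.
Qed.

(** * Permutations with one or two prescribed descents *)

(** One encoding for descent sets of size one and two, a singleton being the pair [(i, i)]. Here the
    elements of ['I_n] stand for 1-based positions, so only nonzero ones occur in descent sets. *)
Definition desc_pair n (u : {perm 'I_n}) (l : 'I_n * 'I_n) : bool :=
  [forall k : 'I_n, (val k \in Des u) == (k == l.1) || (k == l.2)].

Lemma perm_of_fun n (f : nat -> nat) : (forall k, k < n -> f k < n) ->
  (forall k k', k < n -> k' < n -> f k = f k' -> k = k') ->
  exists u : {perm 'I_n}, forall k : 'I_n, val (u k) = f k.
Proof.
case: n => [|n] fn fi; first by exists 1%g => -[].
have inj : injective (fun k : 'I_n.+1 => inord (f k) : 'I_n.+1).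
  move=> k k' /(congr1 val) /=; rewrite !inordK ?fn // => e.
  exact: val_inj (fi _ _ (ltn_ord k) (ltn_ord k') e).
by exists (perm inj) => k; rewrite permE /= inordK ?fn.
Qed.

Lemma desc_pair_fun n (u : {perm 'I_n}) (f : nat -> nat) (i j : 'I_n) :
  (forall k : 'I_n, val (u k) = f k) -> 0 < i -> 0 < j ->
  (forall k, k.+1 < n -> (f k.+1 < f k) = (k.+1 == i) || (k.+1 == j)) ->
  desc_pair u (i, j).
Proof.
move=> uf i0 j0 H; apply/forallP => -[[|k] hk]; apply/eqP; rewrite /= -!val_eqE /=.
  by rewrite inE /=; lia.
by rewrite (DesE u (ltnW hk) hk) !uf H.
Qed.

Lemma desc_pair_count n (i j : 'I_n) (N : nat) (f : nat -> nat -> nat) :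
  0 < i -> 0 < j ->
  (forall c k, c < N -> k < n -> f c k < n) ->
  (forall c k k', c < N -> k < n -> k' < n -> f c k = f c k' -> k = k') ->
  (forall c k, c < N -> k.+1 < n -> (f c k.+1 < f c k) = (k.+1 == i) || (k.+1 == j)) ->
  (forall c c', c < N -> c' < N -> (forall k, k < n -> f c k = f c' k) -> c = c') ->
  N <= #|[set u : {perm 'I_n} | desc_pair u (i, j)]|.
Proof.
move=> i0 j0 fn fi fd fc.
have ex (c : 'I_N) : exists u : {perm 'I_n}, [forall k, val (u k) == f c k].
  have [u hu] := perm_of_fun (fun k => fn c k (ltn_ord c)) (fun k k' => fi c k k' (ltn_ord c)).
  by exists u; apply/forallP => k; rewrite hu.
pose P c := xchoose (ex c).
have PE c k : val (P c k) = f c k by have /forallP/(_ k)/eqP := xchooseP (ex c).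
have Pinj : injective P.
  move=> c c' e; apply: val_inj; apply: (fc _ _ (ltn_ord c) (ltn_ord c')) => k hk.
  by rewrite -(PE c (Ordinal hk)) -(PE c' (Ordinal hk)) e.
rewrite -[N]card_ord -(card_codom Pinj); apply: subset_leq_card.
apply/subsetP => _ /codomP [c ->]; rewrite inE.
by apply: (desc_pair_fun (PE c)) => // k hk; apply: (fd _ _ (ltn_ord c)).
Qed.

Ltac by_ifs := repeat (case: ifP => ?); lia.

(** The identity with one value moved across the descent: for [c < i] the value [c] moves up to
    index [i], otherwise [c + 1] moves down to index [i - 1]. *)
Definition single_fam i c k :=
  if c < i then (if k < c then k else if k < i then k.+1 else if k == i then c else k)
  else (if k < i.-1 then k else if k == i.-1 then c.+1 else if k <= c.+1 then k.-1 else k).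

Lemma single_count n (i : 'I_n) : 0 < i ->
  n - 1 <= #|[set u : {perm 'I_n} | desc_pair u (i, i)]|.
Proof.
move=> i0; apply: (desc_pair_count (f := single_fam i)) => //;
  move: (val i) (ltn_ord i) i0 => {}i hi i0; rewrite /single_fam.
- by move=> c k hc hk; by_ifs.
- by move=> c k k' hc hk hk'; by_ifs.
- by move=> c k hc hk; rewrite orbb; by_ifs.
- move=> c c' hc hc' H; have := H i hi; have := H i.-1.
  have ei b : single_fam i b i = if b < i then b else i.-1 by rewrite /single_fam; by_ifs.
  have ep b : single_fam i b i.-1 = if b < i then i else b.+1 by rewrite /single_fam; by_ifs.
  by rewrite -!/(single_fam _ _ _) !ei !ep; by_ifs.
Qed.

(** The indices [i-1], [i], [i+1] carry [i+1, i, c] if [c < i], and [c+2, i, i-1] otherwise; the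
    remaining values are in increasing order. *)
Definition adjacent_fam i c k :=
  if c < i then (if k < c then k else if k < i.-1 then k.+1 else if k == i.-1 then i.+1
    else if k == i then i else if k == i.+1 then c else k)
  else (if k < i.-1 then k else if k == i.-1 then c.+2 else if k == i then i
    else if k == i.+1 then i.-1 else if k <= c.+2 then k.-1 else k).

Lemma adjacent_count n (i j : 'I_n) : 0 < i -> j = i.+1 :> nat ->
  n - 2 <= #|[set u : {perm 'I_n} | desc_pair u (i, j)]|.
Proof.
move=> i0 ij; apply: (desc_pair_count (f := adjacent_fam i)) => //; first (by rewrite ij);
  have hj := ltn_ord j; move: (nat_of_ord i) (nat_of_ord j) hj i0 ij => {}i {}j hj i0 ij; rewrite /adjacent_fam.
- by move=> c k hc hk; by_ifs.
- by move=> c k k' hc hk hk'; by_ifs.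
- by move=> c k hc hk; by_ifs.
- move=> c c' hc hc' H; have := H i.+1; have := H i.-1.
  have es b : adjacent_fam i b i.+1 = if b < i then b else i.-1 by rewrite /adjacent_fam; by_ifs.
  have ep b : adjacent_fam i b i.-1 = if b < i then i.+1 else b.+2 by rewrite /adjacent_fam; by_ifs.
  by rewrite -!/(adjacent_fam _ _ _) !es !ep; by_ifs.
Qed.

Definition far_fam i j (c k : nat) :=
  if k == i.-1 then i else if k == i then i.-1 else if k == j.-1 then j
  else if k == j then j.-1 else k.

Lemma far_count n (i j : 'I_n) : 0 < i -> i.+1 < j ->
  1 <= #|[set u : {perm 'I_n} | desc_pair u (i, j)]|.
Proof.
move=> i0 ij; apply: (desc_pair_count (f := far_fam i j)) => //; first (by lia);
  have hj := ltn_ord j; move: (nat_of_ord i) (nat_of_ord j) hj i0 ij => {}i {}j hj i0 ij; rewrite /far_fam.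
- by move=> c k hc hk; by_ifs.
- by move=> c k k' hc hk hk'; by_ifs.
- by move=> c k hc hk; by_ifs.
- by move=> c c' hc hc' _; lia.
Qed.

(** * Sufficiency *)

Definition label n (l : 'I_n * 'I_n) : bool := 0 < l.1 <= l.2.

Lemma desc_pair_inj n (u : {perm 'I_n}) l l' :
  label l -> label l' -> desc_pair u l -> desc_pair u l' -> l = l'.
Proof.
case: l l' => i j [i' j'] /= /andP [/= i0 ij] /andP [/= i0' ij'] /forallP h /forallP h'.
have e k : (k == i) || (k == j) = ((k == i') || (k == j')).
  by rewrite -(eqP (h k)) (eqP (h' k)).
have := e i; have := e j; have := e i'; have := e j'; rewrite -!val_eqE /=.
by move=> e1 e2 e3 e4; congr pair; apply: val_inj => /=; lia.
Qed.

(** The first [c l] permutations of each class are taken; the classes are disjoint by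
    [desc_pair_inj]. A general summand [F] serves both for coefficients and for the cardinality. *)
Lemma sets_with_weights n (c : 'I_n * 'I_n -> nat) :
  (forall l, label l -> c l <= #|[set u : {perm 'I_n} | desc_pair u l]|) ->
  exists S : {set {perm 'I_n}},
    (forall u, u \in S -> exists2 l, label l & desc_pair u l) /\
    (forall F G, (forall u l, label l -> desc_pair u l -> F u = G l) ->
      \sum_(u in S) F u = \sum_(l | label l) c l * G l).
Proof.
move=> hc; pose K l := [set u : {perm 'I_n} | desc_pair u l].
pose sel u l := desc_pair u l && (index u (enum (K l)) < c l).
exists [set u | [exists l, label l && sel u l]]; split.
  by move=> u; rewrite inE => /existsP [l /and3P [? ? _]]; exists l.
move=> F G FG.
transitivity (\sum_u \sum_(l | label l) sel u l * G l).
  rewrite big_mkcond; apply: eq_bigr => u _; rewrite inE.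
  case: ifP => [/existsP [l /andP [hl sl]]|/negbT/existsPn h].
    rewrite (bigD1 l) //= sl mul1n big1 ?addn0 => [|l' /andP [hl' ll']].
      by apply: FG => //; case/andP: sl.
    case sl': (sel u l'); rewrite ?mul0n //; case/eqP: ll'.
    by case/andP: sl sl' => du _ /andP [du' _]; apply: (desc_pair_inj (u := u)).
  by rewrite big1 // => l hl; have := h l; rewrite hl /= => /negPf ->.
rewrite exchange_big; apply: eq_bigr => l hl; rewrite -big_distrl /=; congr (_ * _).
transitivity #|take (c l) (enum (K l))|.
  rewrite -sum1_card big_mkcond [RHS]big_mkcond; apply: eq_bigr => u _ /=.
  rewrite /sel; have -> : desc_pair u l = (u \in enum (K l)) by rewrite mem_enum inE.
  case: (boolP (u \in enum (K l))) => hu /=; first by rewrite in_take //; case: (_ < _).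
  by case: ifP => // /mem_take; rewrite (negPf hu).
rewrite (card_uniqP _) ?take_uniq ?enum_uniq // size_takel // -cardE; exact: hc.
Qed.

Lemma sum_label n (g : nat -> nat -> nat) :
  \sum_(l : 'I_n * 'I_n | label l) g l.1 l.2 =
  \sum_(0 <= i < n) \sum_(0 <= j < n) (0 < i <= j) * g i j.
Proof.
rewrite big_mkcond /= big_mkord.
under [RHS]eq_bigr => i _ do rewrite big_mkord.
rewrite pair_bigA /=; apply: eq_bigr => l _; rewrite /label.
by case: ifP; rewrite ?mul1n ?mul0n.
Qed.

Lemma sum_delta n c (g : nat -> nat) :
  \sum_(0 <= j < n) (j == c) * g j = (c < n) * g c.
Proof.
elim: n => [|n IH]; first by rewrite big_nil.
rewrite big_nat_recr //= IH; have [->|ne] := eqVneq n c; first by rewrite ltnn ltnSn.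
by rewrite mul0n addn0 (_ : (c < n.+1) = (c < n)) //; lia.
Qed.

Lemma sum_square n (a : nat -> nat) :
  (\sum_(0 <= i < n) a i) ^ 2 = \sum_(0 <= i < n) a i ^ 2 +
    2 * \sum_(0 <= i < n) \sum_(0 <= j < n) (i < j) * (a i * a j).
Proof.
rewrite -mulnn big_distrl /=.
have -> : \sum_(0 <= i < n) a i * (\sum_(0 <= i0 < n) a i0) =
   \sum_(0 <= i < n) \sum_(0 <= j < n) ((j == i) * (a i * a j) +
     ((i < j) * (a i * a j) + (j < i) * (a i * a j))).
  apply: eq_bigr => i _; rewrite big_distrr /=; apply: eq_bigr => j _.
  by case: ltngtP => _; rewrite ?mul0n ?mul1n ?addn0 ?add0n.
under eq_bigr => i _ do rewrite !big_split /= sum_delta.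
rewrite !big_split /=; congr (_ + _).
  by apply: eq_big_nat => i /andP [_ ->]; rewrite mul1n mulnn.
rewrite mul2n -addnn; congr (_ + _); rewrite exchange_big /=.
by apply: eq_bigr => i _; apply: eq_bigr => j _; rewrite (mulnC (a j)).
Qed.

Lemma size_undup_sorted x s : path leq x s ->
  size (undup (x :: s)) = (\sum_(0 <= i < size s) (nth 0 (x :: s) i < nth 0 (x :: s) i.+1)).+1.
Proof.
elim: s x => [|y s IH] x; first by rewrite big_nil.
move=> /= /andP [xy ps]; rewrite big_nat_recl //= -addnS -(IH _ ps).
move: xy; rewrite leq_eqVlt => /orP [/eqP ->|xy]; first by rewrite inE eqxx ltnn.
have -> : (x \in y :: s) = false.
  apply/negP => xin; have := order_path_min leq_trans ps => /allP h.
  by move: xin; rewrite inE => /orP [/eqP|/h]; lia.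
by rewrite xy.
Qed.

(** Boundaries between blocks of equal letters in a sorted word, the two ends included; a letter
    occurs once when it has a boundary on either side. *)
Definition edge n (v : seq nat) j := [|| j == 0, j == n | nth 0 v j.-1 < nth 0 v j].

Lemma count_mem_sorted v j : sorted leq v -> j < size v ->
  (count_mem (nth 0 v j) v == 1) = edge (size v) v j && edge (size v) v j.+1.
Proof.
move=> sv jv.
have mono a b : a <= b -> b < size v -> nth 0 v a <= nth 0 v b.
  by move=> ab bv; apply: (sorted_leq_nth leq_trans leqnn 0 sv) => //; rewrite inE; lia.
have -> : (count_mem (nth 0 v j) v == 1) =
    (nth 0 v j \notin take j v) && (nth 0 v j \notin drop j.+1 v).
  rewrite -{2}(cat_take_drop j v) (drop_nth 0 jv) count_cat /= eqxx -!has_pred1 !has_count.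
  by move: (count_mem _ (take j v)) (count_mem _ (drop j.+1 v)) => a b; rewrite add1n; lia.
congr (_ && _).
  rewrite /edge; case: j jv => [|j] jv /=; first by rewrite take0.
  rewrite (_ : (j.+1 == size v) = false) /=; last by lia.
  apply/idP/idP => [h|h].
    rewrite ltn_neqAle mono // andbT; apply: contraNneq h => <-.
    by rewrite -(nth_take (n0 := j.+1) 0 (ltnSn j)) mem_nth // size_takel // ltnW.
  apply/negP => /(nthP 0) [i]; rewrite size_takel ?(ltnW jv) // => ij.
  by rewrite nth_take // => e; have := mono i j; rewrite e; lia.
rewrite /edge /=; case: (ltngtP j.+1 (size v)) jv => // [jv _|jv _]; last by rewrite jv drop_size.
apply/idP/idP => [h|h].
  rewrite ltn_neqAle mono // andbT; apply: contraNneq h => ->.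
  by rewrite (drop_nth 0 jv) inE eqxx.
apply/negP => /(nthP 0) [i]; rewrite size_drop nth_drop => ij e.
have m1 : nth 0 v j.+1 <= nth 0 v (j.+1 + i) by apply: mono; rewrite ?leq_addr -?ltn_subRL.
by move: m1; rewrite e leqNgt; move: h => /= ->.
Qed.

Lemma count_sorted v : sorted leq v ->
  count (fun x => count_mem x v == 1) v =
  \sum_(0 <= j < size v) edge (size v) v j * edge (size v) v j.+1.
Proof.
move=> sv; rewrite -sum1_count big_mkcond [LHS](big_nth 0) /=.
apply: eq_big_nat => j /andP [_ jv]; rewrite count_mem_sorted //.
by case: edge; case: edge.
Qed.

(** * Balanced weights on descent sets *)

Section Construction.
Variables (n al ga de ep : nat).
Hypothesis bal : al + ep = ga + de.

Definition weight (l : 'I_n.+4 * 'I_n.+4) : nat :=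
  if val l.1 == val l.2 then (if (val l.1 == 1) || (val l.1 == n.+3) then al else ga)
  else if val l.2 == (val l.1).+1 then de else ep.

(** The pairs [i < j] sum to [(W1^2 - W1) / 2]. Adjacent pairs deviate from the weight [ep] by
    [de - ep], and the two end singletons deviate from [ga] by [al - ga]. By [bal] these deviations
    agree, so they enter only through [W3]. Terms are placed so as to avoid subtraction. *)
Lemma sum_weight (a : nat -> nat) :
  let W1 := \sum_(0 <= i < n.+3) a i.+1 in
  let W3 := a 1 + a n.+3 + \sum_(0 <= i < n.+2) a i.+1 * a i.+2 in
  (forall i, a i ^ 2 = a i) ->
  2 * \sum_(l | label l) weight l * (a (val l.1) * a (val l.2)) + 2 * ep * W3 + ep * W1 =
  2 * ga * W1 + ep * W1 ^ 2 + 2 * de * W3.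
Proof.
move=> W1 W3 a2; pose b i := (0 < i) * a i.
have b2 i : b i ^ 2 = b i by rewrite /b expnMn a2; case: i.
have bS : \sum_(0 <= i < n.+4) b i = W1.
  by rewrite big_nat_recl //= {1}/b mul0n add0n; apply: eq_bigr => i _; rewrite /b mul1n.
pose Q2 := \sum_(0 <= i < n.+4) \sum_(0 <= j < n.+4) (i < j) * (b i * b j).
have sq : W1 ^ 2 = W1 + 2 * Q2.
  by rewrite -bS sum_square; congr (_ + _); apply: eq_bigr => i _.
have b0 : b 0 = 0 by [].
have bE i : b i.+1 = a i.+1 by rewrite /b mul1n.
have W1E : W1 = \sum_(0 <= i < n.+4) \sum_(0 <= j < n.+4) (j == i) * b i.
  rewrite -bS; apply: eq_big_nat => i /andP [_ hi].
  by rewrite (sum_delta _ _ (fun=> b i)) hi mul1n.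
have W3E : W3 = \sum_(0 <= i < n.+4) \sum_(0 <= j < n.+4)
    ((j == i) * ((i == 1) * b i + (i == n.+3) * b i) + (j == i.+1) * (b i * b j)).
  transitivity (\sum_(0 <= i < n.+4) ((i == 1) * b i + (i == n.+3) * b i +
     (i.+1 < n.+4) * (b i * b i.+1))); last first.
    apply: eq_big_nat => i /andP [_ hi]; rewrite big_split /=.
    by rewrite !sum_delta hi mul1n.
  rewrite !big_split /= !sum_delta /W3; congr (_ + _ + _).
  - by rewrite /b !mul1n.
  - by rewrite /b ltnSn !mul1n.
  rewrite [RHS]big_nat_recr //= [X in _ = X + _]big_nat_recl //= b0 ltnn !mul0n muln0 add0n addn0.
  by apply: eq_big_nat => i /andP [_ hi]; rewrite !bE (_ : (i.+2 < n.+4) = true) ?mul1n //; lia.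
suff H : \sum_(l | label l) weight l * (a (val l.1) * a (val l.2)) + ep * W3 =
    ga * W1 + ep * Q2 + de * W3.
  by rewrite sq; move: H; move: (\sum_(l | _) _) => Q; lia.
pose g i j := (if i == j then (if (i == 1) || (i == n.+3) then al else ga)
  else if j == i.+1 then de else ep) * (a i * a j).
rewrite (sum_label _ g) W3E W1E /Q2 !big_distrr -!big_split /=.
apply: eq_bigr => i _; rewrite !big_distrr -!big_split /=; apply: eq_bigr => j _.
rewrite /g; case: i => [|i]; first by rewrite b0 !(mul0n, muln0).
have [->|ij] := eqVneq j i.+1.
  rewrite ltnn leqnn bE [a i.+1 * a i.+1]mulnn a2 !mul1n.
  rewrite (_ : (i.+1 == i.+2) = false) ?mul0n ?muln0 ?addn0; last lia.
  have [e1|e1] := eqVneq i.+1 1; have [e2|e2] := eqVneq i.+1 n.+3; try lia.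
  - by rewrite /= mul1n mul0n addn0 -!mulnDl bal.
  - by rewrite /= mul1n mul0n add0n -!mulnDl bal.
  - by rewrite /= !mul0n !muln0 !addn0.
rewrite !mul0n !muln0 !add0n.
case: (ltnP i.+1 j) => lij; last first.
  rewrite (_ : (i.+1 <= j) = false) 1?(_ : (j == i.+2) = false) ?mul0n ?muln0 //; lia.
case: j ij lij => // j ij lij; rewrite !bE (ltnW lij) !mul1n.
by case: (j.+1 == i.+2); rewrite ?mul1n ?mul0n ?muln0 ?addn0 // addnC.
Qed.

End Construction.

Definition ascent (w : seq nat) j : bool := nth 0 (sort leq w) j.-1 < nth 0 (sort leq w) j.

Lemma Fcoef_desc_pair n (u : {perm 'I_n}) l w : label l -> desc_pair u l ->
  Fcoef n (Des u) w = (size w == n) * (ascent w (val l.1) * ascent w (val l.2)).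
Proof.
case: l => i j /andP [/= i0 ij] /forallP h; rewrite /Fcoef mulnb.
case: eqP => // _; rewrite mul1n /=; congr nat_of_bool.
have hD (k : 'I_n) : (val k \in Des u) = (k == i) || (k == j) by apply/eqP/h.
apply/allP/andP => [H|[ai aj] k].
  by split; apply: (implyP (H _ _)); rewrite ?hD ?eqxx ?orbT // mem_iota /=;
    have := ltn_ord i; have := ltn_ord j; lia.
rewrite mem_iota => hk; apply/implyP => kD.
have kn : k < n by lia.
have := hD (Ordinal kn); rewrite /= kD -!val_eqE /= => /esym /orP [] /eqP ->.
  exact: ai.
exact: aj.
Qed.

Lemma sum_ascent n w : size w = n.+4 ->
  (\sum_(0 <= i < n.+3) ascent w i.+1).+1 = size (undup w).
Proof.
move=> sw; rewrite -(perm_size (perm_undup (mem_sort leq w))) /ascent.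
have := sort_sorted leq_total w; have : size (sort leq w) = n.+4 by rewrite size_sort.
by case: (sort leq w) => // x s [<-] sx; rewrite size_undup_sorted.
Qed.

Lemma count_ascent n w : size w = n.+4 ->
  ascent w 1 + ascent w n.+3 + \sum_(0 <= i < n.+2) ascent w i.+1 * ascent w i.+2 =
  count (fun x => count_mem x w == 1) w.
Proof.
move=> sw; have pw : perm_eq (sort leq w) w by rewrite perm_sort.
rewrite -(seq.permP pw) (eq_count (a2 := fun x => count_mem x (sort leq w) == 1)); last first.
  by move=> x /=; rewrite (seq.permP pw).
rewrite (count_sorted (sort_sorted leq_total w)) !size_sort sw.
have eE j : 0 < j < n.+4 -> edge n.+4 (sort leq w) j = ascent w j.
  by rewrite /edge; case: eqP => [->//|_]; case: eqP => [->|//]; rewrite ltnn andbF.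
have e0 : edge n.+4 (sort leq w) 0 by [].
have eN : edge n.+4 (sort leq w) n.+4 by rewrite /edge eqxx orbT.
rewrite [RHS]big_nat_recl // [X in _ = _ + X]big_nat_recr // e0 eN eE // eE; last by lia.
rewrite muln1 mul1n -addnA [X in _ + X = _]addnC; congr (_ + (_ + _)).
by apply: eq_big_nat => i /andP [_ hi]; rewrite !eE //; lia.
Qed.

(** The bounds on the weights are the class sizes found above. Renaming variables preserves the
    number of distinct letters and the number of letters occurring once, which determine the
    coefficient by [sum_weight]. *)
Lemma construction n al ga de ep : al + ep = ga + de ->
  al <= n.+3 -> ga <= n.+3 -> de <= n.+2 -> ep <= 1 ->
  exists S : {set {perm 'I_n.+4}},
    [/\ symmetric_set S, iota_perm n.+4 \notin S, delta_perm n.+4 \notin S &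
     2 * #|S| + 2 * ep * n.+4 + ep * n.+3 = 2 * ga * n.+3 + ep * n.+3 ^ 2 + 2 * de * n.+4].
Proof.
move=> bal hal hga hde hep; pose c := @weight n al ga de ep.
have hc l : label l -> c l <= #|[set u : {perm 'I_n.+4} | desc_pair u l]|.
  case: l => i j /andP [/= i0 ij]; rewrite /c /weight /=.
  have [e|ne] := eqVneq (val i) (val j).
    rewrite -(val_inj e); apply: leq_trans (single_count i0); case: ifP => _; lia.
  have [e|ne'] := eqVneq (val j) (val i).+1.
    by apply: leq_trans (adjacent_count i0 e); lia.
  by apply: leq_trans hep (far_count i0 _); move: ij ne ne' => /=; lia.
have [S [memS sumS]] := sets_with_weights hc.
have a2 w i : (ascent w i : nat) ^ 2 = ascent w i by case: ascent.
have Q w : size w = n.+4 ->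
   2 * Qcoef S w + 2 * ep * count (fun x => count_mem x w == 1) w + ep * (size (undup w)).-1 =
   2 * ga * (size (undup w)).-1 + ep * (size (undup w)).-1 ^ 2 +
   2 * de * count (fun x => count_mem x w == 1) w.
  move=> sw; have := sum_weight n bal (a2 w).
  rewrite count_ascent // -(sum_ascent sw) /= => <-.
  congr (2 * _ + _ + _); rewrite /Qcoef.
  rewrite (sumS _ (fun l => ascent w (val l.1) * ascent w (val l.2))) //.
  by move=> u l hl ul; rewrite (Fcoef_desc_pair w hl ul) sw eqxx mul1n.
exists S; split.
- move=> s bs w; have [sw|sw] := eqVneq (size w) n.+4; last first.
    by rewrite /Qcoef !big1 // => u _; rewrite /Fcoef ?size_map (negPf sw).
  have inj_s := bij_inj bs; have sw' : size (map s w) = n.+4 by rewrite size_map.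
  have := Q _ sw'; rewrite undup_map_inj // size_map count_map.
  rewrite (eq_count (a2 := fun x => count_mem x w == 1)); last first.
    move=> x /=; rewrite count_map; congr (_ == _); apply: eq_count => y /=.
    exact: inj_eq.
  by rewrite -(Q _ sw); lia.
- apply/negP => /memS [[i j] /andP [/= i0 _] /forallP /(_ i)]; rewrite eqxx /= => /eqP.
  case: i i0 => [[|k] hk] // _; rewrite /= (DesE _ (ltnW hk) hk) !perm1 /=; lia.
- apply/negP => /memS [[i j] /andP [/= i0 ij] /forallP h].
  have hD k (hk : k.+1 < n.+4) : (k.+1 == i) || (k.+1 == j).
    have := h (Ordinal hk); rewrite -!val_eqE /= => /eqP <-.
    rewrite (DesE _ (ltnW hk) hk) !permE /=; lia.
  by have := hD 0 isT; have := hD 1 isT; have := hD 2 isT; lia.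
(* All indicators equal to 1 correspond to a word with distinct letters, whose coefficient is the
   size of [S]. *)
- have := sum_weight n bal (a := fun=> 1) (fun=> erefl).
  rewrite !sum_nat_const_nat !subn0 !muln1 (_ : 1 + 1 + n.+2 = n.+4) // => <-.
  congr (2 * _ + _ + _); rewrite -sum1_card (sumS _ (fun=> 1)) //.
Qed.

Lemma backward n p : 52 <= n -> p < (n - 1) * (n - 3) ->
  [\/ cond1 n p, cond2 n p | cond3 n p] ->
  exists S : {set {perm 'I_n}},
    [/\ symmetric_set S, #|S| = p, iota_perm n \notin S & delta_perm n \notin S].
Proof.
case: n => [|[|[|[|k]]]] // n52; rewrite subn1 (_ : k.+4 - 3 = k.+1) //= => hp.
have fin al ga de ep : al + ep = ga + de -> al <= k.+3 -> ga <= k.+3 -> de <= k.+2 -> ep <= 1 ->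
    2 * p + 2 * ep * k.+4 + ep * k.+3 = 2 * ga * k.+3 + ep * k.+3 ^ 2 + 2 * de * k.+4 ->
    exists S : {set {perm 'I_k.+4}},
      [/\ symmetric_set S, #|S| = p, iota_perm k.+4 \notin S & delta_perm k.+4 \notin S].
  move=> h1 h2 h3 h4 h5 e; have [S [sym nI nD cS]] := construction h1 h2 h3 h4 h5.
  by exists S; split=> //; lia.
case=> [[q [r [rq qn pq]]]|[on [c pc]]|[on [c pc]]].
- have [d hd] : exists d, q = d + r by exists (q - r); lia.
  by apply: (fin q r d 0); subst q; rewrite ?mul0n ?muln0 //; lia.
- have [j hj] : exists j, k = j.*2 by exists k./2; lia.
  subst k; move: pc; rewrite half_even subn1 /= => pc.
  have hcj : c <= j.*2.+2 by nia.
  (* With [ep = 1] and [de = 0] the size is [n(n-3)/2 + (ga - 1) (n-1)]. *)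
  by apply: (fin c c.+1 0 1) => //; lia.
have [j hj] : exists j, k = j.*2.+1 by exists k./2; lia.
subst k; move: pc; rewrite bin2_odd => pc.
have hcj : c <= j.*2.+2 by nia.
(* With [ep = 1] and [ga = 0] the size is [C(n-1,2) + (de - 1) n]. *)
by apply: (fin c 0 c.+1 1) => //; lia.
Qed.

Theorem theorem1p2 (n p : nat) :
  52 <= n -> p < (n - 1) * (n - 3) ->
  (exists S : {set {perm 'I_n}},
      [/\ symmetric_set S, #|S| = p, iota_perm n \notin S & delta_perm n \notin S])
  <->
  [\/ [/\ cond1 n p, ~ cond2 n p & ~ cond3 n p],
      [/\ ~ cond1 n p, cond2 n p & ~ cond3 n p]
    | [/\ ~ cond1 n p, ~ cond2 n p & cond3 n p]].
Proof.
move=> n52 hp; have n12 := not_cond12 n52 (p := p); have n13 := not_cond13 n52 (p := p).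
have n23 : cond2 n p -> cond3 n p -> False by case=> /negP ev _ [].
split=> [[S [sym cS nI nD]]|H].
  case: (forward n52 hp sym cS nI nD) => h; [apply: Or31 | apply: Or32 | apply: Or33].
  - by split=> // ?; [apply: n12 | apply: n13].
  - by split=> // ?; [apply: n12 | apply: n23].
  - by split=> // ?; [apply: n13 | apply: n23].
by apply: (backward n52 hp); case: H => -[? ? ?]; [apply: Or31 | apply: Or32 | apply: Or33].
Qed.
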